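(* Let $p\geq 7$ be a prime, let $F$ be a group of order $12$, let $\tau:F\to\mathbf{Z}_p^*$ be a group morphism, and let $G=\mathbf{Z}_p\rtimes_\tau F$. Let $K/k$ be a Galois field extension with Galois group $G$. The number of Hopf Galois structures of type $C_{6p}\times C_2$ on $K/k$ is determined by $F$ and the isomorphism class of $\ker\tau$ as follows (for each entry it is assumed that $p$ is such that a morphism $\tau$ with the given kernel exists; the listed kernels are the only ones that can occur): - $F\cong C_{12}$: $1$ if $\ker\tau=F$; $p$ if $\ker\tau$ is isomorphic to $C_6$, $C_4$, $C_3$, $C_2$ or $\{1\}$. - $F\cong C_6\times C_2$: $1$ if $\ker\tau=F$; $p$ if $\ker\tau$ is isomorphic to $C_6$, $C_2^2$ or $C_2$. - $F\cong A_4$: $4$ if $\ker\tau=F$; $4p$ if $\ker\tau\cong C_2^2$. - $F\cong D_{2\cdot 6}$: $3$ if $\ker\tau=F$; $3p$ if $\ker\tau$ is isomorphic to $C_6$ or $D_{2\cdot 3}$. - $F\cong\mathrm{Dic}_{12}$: $3$ if $\ker\tau=F$; $3p$ if $\ker\tau$ is isomorphic to $C_6$ or $C_3$.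
   Context: $\mathbf{Z}_p=\mathbf{Z}/p\mathbf{Z}$, with $\mathrm{Aut}(\mathbf{Z}_p)$ identified with $\mathbf{Z}_p^*$. $C_m$ is the cyclic group of order $m$, $D_{2\cdot m}$ the dihedral group of order $2m$, $A_4$ the alternating group on four letters, and $\mathrm{Dic}_{12}=\langle x,y\mid x^3=1,y^4=1,yxy^{-1}=x^2\rangle$ the dicyclic group of order 12; these give all groups of order 12: $C_{12}$, $C_6\times C_2$, $A_4$, $D_{2\cdot 6}$, $\mathrm{Dic}_{12}$. A Hopf Galois structure on a finite field extension $K/k$ is a pair $(\mathcal{H},\mu)$ where $\mathcal{H}$ is a finite cocommutative $k$-Hopf algebra and $\mu:\mathcal{H}\to\mathrm{End}_k(K)$ is a $k$-linear map giving $K$ a left $\mathcal{H}$-module algebra structure and inducing a bijection $K\otimes_k\mathcal{H}\to\mathrm{End}_k(K)$. For $K/k$ Galois with group $G$, by Greither and Pareigis, Hopf Galois structures on $K/k$ are in bijection with regular subgroups $N$ of $\mathrm{Sym}(G)$ normalized by $\lambda(G)$, where $\lambda$ is left translation; the type of the structure is the isomorphism class of $N$. *)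

(* Defs.v *)
From HB Require Import structures.
From mathcomp Require Import all_boot all_order all_algebra all_fingroup.
From mathcomp Require Import all_solvable all_field.

Set Implicit Arguments.
Unset Strict Implicit.
Unset Printing Implicit Defensive.

Import GRing.Theory.
Local Open Scope ring_scope.

(* The tensor product of two finite-dimensional spaces, in coordinates: the   *)
(* (i, j) entry of t : tensor U V is its coefficient on e_i (x) f_j, where    *)
(* (e_i) and (f_j) are the bases vbasis {:U} and vbasis {:V}.                 *)
Definition tensor (k : fieldType) (U V : vectType k) : vectType k :=
  'M[k]_(\dim {:U}, \dim {:V}).

Definition tens (k : fieldType) (U V : vectType k) (u : U) (v : V) :
    tensor U V :=
  \matrix_(i, j) (coord (vbasis {:U}) i u * coord (vbasis {:V}) j v).

(* When f is bilinear this is the linear map with u (x) v |-> f u v.          *)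
Definition tlift (k : fieldType) (U V W : vectType k) (f : U -> V -> W)
    (t : tensor U V) : W :=
  \sum_i \sum_j
    (t : 'M[k]_(_, _)) i j *: f (vbasis {:U})`_i (vbasis {:V})`_j.

(* Finite cocommutative Hopf algebras over k; an falgType is a                *)
(* finite-dimensional associative unital algebra.                             *)
Record hopfAlgebra (k : fieldType) := HopfAlgebra {
  hopf_sort :> falgType k;
  comul : {linear hopf_sort -> tensor hopf_sort hopf_sort};
  counit : {linear hopf_sort -> k^o};
  antipode : {linear hopf_sort -> hopf_sort};
  comulA : forall h,
    tlift (fun x y => tlift (fun a b => tens a (tens b y)) (comul x)) (comul h)
    = tlift (fun x y => tens x (comul y)) (comul h);
  counitl : forall h, tlift (fun x y => counit x *: y) (comul h) = h;
  counitr : forall h, tlift (fun x y => counit y *: x) (comul h) = h;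
  comul1 : comul 1 = tens 1 1;
  comulM : forall g h : hopf_sort,
    comul (g * h) =
      tlift (fun a b => tlift (fun c d => tens (a * c) (b * d)) (comul h))
            (comul g);
  counit1 : counit 1 = 1;
  counitM : forall g h : hopf_sort, counit (g * h) = counit g * counit h;
  antipodel : forall h,
    tlift (fun x y => antipode x * y) (comul h) = (counit h)%:A;
  antipoder : forall h,
    tlift (fun x y => x * antipode y) (comul h) = (counit h)%:A;
  comulC : forall h, tlift (fun x y => tens y x) (comul h) = comul h
}.
Arguments comul {k _}.
Arguments counit {k _}.
Arguments antipode {k _}.

Record hopfGalois (k : fieldType) (K : fieldExtType k) := HopfGalois {
  hg_alg :> hopfAlgebra k;
  hg_act : {linear hg_alg -> 'End(K)};
  hg_act1 : hg_act 1 = \1%VF;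
  hg_actM : forall g h : hg_alg, hg_act (g * h) = (hg_act g \o hg_act h)%VF;
  hg_act_mul : forall (h : hg_alg) (x y : K),
    hg_act h (x * y) = tlift (fun a b => hg_act a x * hg_act b y) (comul h);
  hg_act_one : forall h : hg_alg, hg_act h 1 = (counit h)%:A;
  hg_bij : bijective
    (fun t : tensor K hg_alg => tlift (fun s h => (amull s \o hg_act h)%VF) t)
}.
Arguments hg_act {k K _}.

(* An isomorphism of bialgebras automatically commutes with the antipodes.    *)
Definition hg_iso (k : fieldType) (K : fieldExtType k) (A B : hopfGalois K) :=
  exists f : {linear A -> B},
    [/\ bijective f,
        f 1 = 1 /\ (forall g h, f (g * h) = f g * f h),
        forall h, comul (f h) = tlift (fun x y => tens (f x) (f y)) (comul h),
        forall h, counit (f h) = counit h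
      & forall h, hg_act (f h) = hg_act h].

Section GreitherPareigis.

Variables (k : fieldType) (K : splittingFieldType k).

Local Notation galG := (gal_of {:K}).

(* galG, the type of all k-automorphisms of K, is the carrier of              *)
(* 'Gal({:K} / 1). Products in galG and in {perm galG} are compositions read  *)
(* from left to right: (g * h)%g x = h (g x). So left translation by g,       *)
(* h |-> g o h, is h |-> (h * g)%g, composition m o n of permutations is      *)
(* (n * m)%g, and lambda g o n o (lambda g)^-1 is (n ^ lambda g)%g.           *)
Definition lambda (g : galG) : {perm galG} := perm (mulIg g).

Definition regular_perm (N : {group {perm galG}}) :=
  forall x y : galG, exists! n, n \in N /\ n x = y.

Definition lambda_normalized (N : {group {perm galG}}) :=
  forall g, lambda g \in 'N(N)%g.

(* The Hopf Galois structure A corresponds to N: phi identifies the Hopf      *)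
(* algebra of A with the Hopf subalgebra K[N]^G of the group algebra K[N],    *)
(* where G acts on K by field automorphisms and on N by conjugation by        *)
(* lambda(G), and A acts on K by                                              *)
(*   (sum_n c_n n) . x = sum_n c_n (n^-1(1_G))(x).                            *)
(* An element of K[N] is given by its family of coefficients, extended by 0   *)
(* to all permutations.                                                       *)
Definition corresponds (A : hopfGalois K) (N : {group {perm galG}}) :=
  exists phi : {linear A -> {ffun {perm galG} -> K}},
    [/\ injective phi,
        forall c : {ffun {perm galG} -> K},
          (exists h, phi h = c) <->
          (forall n, n \notin N -> c n = 0) /\
          (forall g n, c (n ^ lambda g)%g = g (c n)),
        phi 1 = [ffun n => (n == 1%g)%:R] /\
        (forall h h' n, phi (h * h') n =
           \sum_(m in N) \sum_(m' in N | n == (m' * m)%g) phi h m * phi h' m'),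
        (forall h, \sum_(n in N) phi h n = (counit h : k)%:A) /\
        (forall h m n, tlift (fun x y => phi x m * phi y n) (comul h) =
           if m == n then phi h n else 0)
      & forall h x, hg_act h x = \sum_(n in N) phi h n * (n^-1%g 1%g : galG) x].

Definition has_type (A : hopfGalois K) (gT : finGroupType) (T : {group gT}) :=
  exists N : {group {perm galG}},
    [/\ regular_perm N, lambda_normalized N, corresponds A N & N \isog T].

(* There are exactly m Hopf Galois structures of type T on K/k, up to         *)
(* isomorphism.                                                               *)
Definition num_hopfGalois (gT : finGroupType) (T : {group gT}) (m : nat) :=
  exists s : 'I_m -> hopfGalois K,
    [/\ forall i, has_type (s i) T,
        forall i j, hg_iso (s i) (s j) -> i = j
      & forall A, has_type A T -> exists i, hg_iso A (s i)].

End GreitherPareigis.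

(* 'U is the action of 'F_p^* on the additive group of 'F_p by multiplication *)
(* and actions are right actions: x ^ a = tau a * x in sdprod_by. With left   *)
(* actions, a x a^-1 = tau a * x, this would be the semidirect product for    *)
(* a |-> (tau a)^-1, a morphism with the same kernel as tau.                  *)
Definition Zp_sdprod (p : nat) (gF : finGroupType) (F : {group gF})
    (tau : {morphism F >-> {unit 'F_p}}) : finGroupType :=
  sdprod_by ('U \o tau)%gact.

Definition isog_Dic12 (gT : finGroupType) (A : {set gT}) : Prop :=
  (A \isog Grp (x : y : x ^+ 3, y ^+ 4, y * x * y^-1 = x ^+ 2))%g.

(* Main.v *)
From HB Require Import structures.
Require Import Defs.
From mathcomp Require Import all_boot all_order all_algebra all_fingroup.
From mathcomp Require Import all_solvable all_field.

Set Implicit Arguments.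
Unset Strict Implicit.
Unset Printing Implicit Defensive.

Import GRing.Theory.
Local Open Scope ring_scope.

(** A Hopf Galois structure corresponding to a regular subgroup N normalized by
    lambda(G) is unique up to isomorphism, and it determines N: its action on K
    expresses the coefficients of its elements through the independent
    automorphisms, and the multiplication of these coefficients is the table of
    N. Conversely every N occurs, for the fixed algebra K[N]^G, by Galois
    descent. So the Hopf Galois structures of a given type are as many as the
    regular subgroups of that type normalized by the translations of G
    (num_hopfGalois_card); in the convention for products used here, these are
    the right translations rmul g.

    Let N be such a subgroup with N isomorphic to C_6p x C_2. Its Sylow subgroups
    are C_p, C_3 and C_2^2. For q = p, 3, 2 the orbits of the q'-part of N are
    the right cosets of a subgroup H_q of G, of order 12, 4p, 3p respectively,
    and N acts on these p, 3 or 4 cosets through its Sylow q-subgroup, as a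
    regular group normalized by G. There is only one such group of permutations:
    Alt(3) on three points, the normal Klein group on four points, and on p
    points the image of the normal subgroup of order p of G, because on these
    points N commutes with that image. As the three orders have no common prime factor, G embeds in
    the product of the three coset spaces. So N is the group of all permutations
    that induce such translations on each coset space; it is determined by the
    triple (H_p, H_3, H_2), and every triple of subgroups of these orders comes
    from some N. Hence the number of N is the number of subgroups of G of order
    12, times that of order 4p, times that of order 3p (card_regular_subgroups).

    The subgroups of order 12 are the complements of Z_p: there is one when
    tau is trivial, and otherwise there are p. The subgroups of order 4p and 3p
    contain Z_p, so they are as many as the Sylow 2-subgroups and Sylow
    3-subgroups of F. A group of order 12 whose Sylow subgroups are all normal is
    abelian, so a normal Sylow subgroup and noncommutativity determine both
    numbers: (1, 1) for abelian F, (1, 4) for A_4, (3, 1) for D_12 and Dic_12.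

    Finally F_p^* is cyclic, so F / ker tau is cyclic and ker tau contains the
    derived subgroup of F; this restricts the kernels to the given list. *)

(** * Linear maps on tensors *)
Section TensorLift.

Variable k : fieldType.
Implicit Types U V W : vectType k.

Lemma eq_tlift U V W (f f' : U -> V -> W) (t : tensor U V) :
  (forall x y, f x y = f' x y) -> tlift f t = tlift f' t.
Proof.
by move=> eqf; apply: eq_bigr => i _; apply: eq_bigr => j _; rewrite eqf.
Qed.

Lemma tlift_linear U V W (f : U -> V -> W) : linear (tlift f).
Proof.
move=> a t u; rewrite /tlift scaler_sumr -big_split; apply: eq_bigr => i _.
rewrite scaler_sumr -big_split; apply: eq_bigr => j _ /=.
by rewrite !mxE scalerDl scalerA.
Qed.

Lemma linear_tlift U V W W' (L : W -> W') (f : U -> V -> W) (t : tensor U V) :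
  linear L -> L (tlift f t) = tlift (fun x y => L (f x y)) t.
Proof.
move=> linL.
pose mL := GRing.isLinear.Build k W W' _ L linL.
pose L' : {linear W -> W'} := HB.pack L mL.
rewrite -[L]/(L' : W -> W') [LHS]linear_sum; apply: eq_bigr => i _.
by rewrite linear_sum; apply: eq_bigr => j _; rewrite linearZ.
Qed.

Lemma tlift_tens U V W (f : U -> V -> W) u v :
  (forall y, linear (f^~ y)) -> (forall x, linear (f x)) ->
  tlift f (tens u v) = f u v.
Proof.
move=> linl linr.
have suml y n (a : 'I_n -> k) (x : 'I_n -> U) :
    f (\sum_i a i *: x i) y = \sum_i a i *: f (x i) y.
  pose mL := GRing.isLinear.Build k U W _ (f^~ y) (linl y).
  pose L : {linear U -> W} := HB.pack (f^~ y) mL.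
  rewrite -[LHS]/(L _) linear_sum; apply: eq_bigr => i _; exact: linearZ.
have sumr x n (a : 'I_n -> k) (y : 'I_n -> V) :
    f x (\sum_i a i *: y i) = \sum_i a i *: f x (y i).
  pose mL := GRing.isLinear.Build k V W _ (f x) (linr x).
  pose L : {linear V -> W} := HB.pack (f x) mL.
  rewrite -[LHS]/(L _) linear_sum; apply: eq_bigr => i _; exact: linearZ.
rewrite {2}(coord_vbasis (memvf u)) suml; apply: eq_bigr => i _.
rewrite {2}(coord_vbasis (memvf v)) sumr scaler_sumr; apply: eq_bigr => j _.
by rewrite mxE scalerA.
Qed.

End TensorLift.

(** * Endomorphisms of K as combinations of automorphisms *)
Section GaloisCoefficients.

Variables (k : fieldType) (K : splittingFieldType k).
Local Notation galG := (gal_of {:K}).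
Implicit Types (g h : galG) (x y : K) (F : 'End(K)).

(** A k-linear retraction of the inclusion of k in K; it recovers the scalar
    behind an element of K that the Galois group fixes. *)
Definition kcoord : K -> k := coord [tuple (1 : K)] ord0.

Lemma kcoord_linear a x y : kcoord (a *: x + y) = a * kcoord x + kcoord y.
Proof. exact: linearP. Qed.

Lemma kcoord_alg a : kcoord a%:A = a.
Proof.
rewrite /kcoord linearZ /= (coord_free ord0 ord0) ?mulr1 //.
by rewrite seq1_free oner_neq0.
Qed.

Lemma galMf g h x : (g * h)%g x = h (g x).
Proof. exact/galM/memvf. Qed.

(** A tuple w on which the automorphisms have an invertible matrix (g (w_j)), and
    the column gdual of the inverse matrix at the identity. *)
Definition gbasis := sval (@gal_matrix _ _ {:K}%AS setT).
Definition gmx := \matrix_(i, j < #|[set: galG]|) enum_val i (tnth gbasis j).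
Definition gdual (j : 'I_#|[set: galG]|) : K :=
  invmx gmx j (enum_rank_in (in_setT (1%g : galG)) 1%g).

Lemma gdualP g : \sum_j g (tnth gbasis j) * gdual j = (g == 1%g)%:R.
Proof.
have umx : gmx \in unitmx.
  by rewrite /gmx /gbasis; have [_ []] := svalP (@gal_matrix _ _ {:K}%AS setT).
move/mulmxV/matrixP: umx => /(_ (enum_rank_in (in_setT g) g)
  (enum_rank_in (in_setT (1%g : galG)) 1%g)).
rewrite !mxE => eq1; transitivity ((g == 1%g)%:R : K); last by [].
have -> : (g == 1%g) = (enum_rank_in (in_setT g) g ==
   enum_rank_in (in_setT (1%g : galG)) 1%g).
  by rewrite -(inj_eq enum_val_inj) !enum_rankK_in ?inE.
rewrite -eq1; apply: eq_bigr => j _; rewrite mxE enum_rankK_in ?inE //.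
Qed.

(** Apply h to the defining relation of gdual for g h^-1. *)
Lemma gdualJ g h :
  \sum_j g (tnth gbasis j) * h (gdual j) = (g == h)%:R.
Proof.
have := congr1 h (gdualP (g * h^-1)%g).
rewrite rmorph_sum rmorph_nat -eq_mulgV1 => <-.
by apply: eq_bigr => j _; rewrite rmorphM /= -galMf mulgKV.
Qed.

Definition gtrace x := \sum_(g : galG) g x.

(** Since sum_j g (w_j) gdual_j vanishes for g <> 1, only g = 1 survives in the sum
    of the traces: K is recovered from the fixed elements. This drives descent. *)
Lemma gtraceE x : x = \sum_j gdual j * gtrace (tnth gbasis j * x).
Proof.
under eq_bigr => j _ do rewrite mulr_sumr.
rewrite exchange_big (bigD1 1%g) //= [X in _ + X]big1 ?addr0 => [|g g1].
  under eq_bigr => j _ do rewrite rmorphM /= mulrA [gdual j * _]mulrC.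
  by rewrite -mulr_suml gdualP eqxx mul1r gal_id.
under eq_bigr => j _ do rewrite rmorphM /= mulrA [gdual j * _]mulrC.
by rewrite -mulr_suml gdualP (negPf g1) mul0r.
Qed.

Lemma gtrace_fixed g x : g (gtrace x) = gtrace x.
Proof.
rewrite rmorph_sum [RHS](reindex_inj (mulIg g)).
by apply: eq_bigr => h _; rewrite galMf.
Qed.

(** The coefficient of g in the expression of F as a K-combination of
    automorphisms. *)
Definition gcoef g F := \sum_j F (tnth gbasis j) * g (gdual j).

Lemma gcoef_linear g : linear (gcoef g).
Proof.
move=> a F F'; rewrite /gcoef scaler_sumr -big_split; apply: eq_bigr => j _ /=.
by rewrite add_lfunE scale_lfunE mulrDl scalerAl.
Qed.

Lemma gcoef_unique (c : galG -> K) F g :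
  (forall x, F x = \sum_h c h * h x) -> gcoef g F = c g.
Proof.
move=> Fc; rewrite /gcoef; under eq_bigr => j _ do rewrite Fc mulr_suml.
rewrite exchange_big (bigD1 g) //= [X in _ + X]big1 ?addr0 => [|h hg].
  by under eq_bigr => j _ do rewrite -mulrA; rewrite -mulr_sumr gdualJ eqxx mulr1.
under eq_bigr => j _ do rewrite -mulrA.
by rewrite -mulr_sumr gdualJ (negPf hg) mulr0.
Qed.

Hypothesis galK : galois 1 {:K}.

Lemma gal_fixed_alg x : (forall g, g x = x) -> (kcoord x)%:A = x.
Proof.
move=> fixx; have /vlineP[a ->] : x \in 1%VS.
  rewrite -(galois_fixedField galK).
  by apply/fixedFieldP => [|g _]; rewrite ?memvf.
by rewrite kcoord_alg.
Qed.

(** Here K / k is Galois: x is the sum of the tr (gdual_j x) w_j, by the dual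
    relation, and F is linear over the field k that contains the traces. *)
Lemma gcoefE F x : F x = \sum_g gcoef g F * g x.
Proof.
have xE : x = \sum_j gtrace (gdual j * x) * tnth gbasis j.
  under eq_bigr => j _ do rewrite mulr_suml.
  rewrite exchange_big (bigD1 1%g) //= [X in _ + X]big1 ?addr0 => [|g g1].
    under eq_bigr => j _ do rewrite gal_id mulrAC [_ * tnth _ _]mulrC.
    rewrite -mulr_suml -[LHS]mul1r; congr (_ * _).
    transitivity ((1%g == 1%g :> galG)%:R : K); first by rewrite eqxx.
    by rewrite -gdualP; apply: eq_bigr => j _; rewrite gal_id.
  under eq_bigr => j _ do rewrite rmorphM /= mulrAC [_ * tnth _ _]mulrC.
  rewrite -mulr_suml.
  under eq_bigr => j _ do rewrite -[tnth _ j](gal_id {:K}).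
  by rewrite gdualJ eq_sym (negPf g1) mul0r.
rewrite {1}xE linear_sum /gcoef.
under [RHS]eq_bigr => g _ do rewrite mulr_suml.
rewrite exchange_big; apply: eq_bigr => j _.
rewrite -(gal_fixed_alg (fun g => gtrace_fixed g _)).
rewrite -scalerAl mul1r linearZ /= -[_ *: _]mulr_algl gal_fixed_alg; last first.
  by move=> g; apply: gtrace_fixed.
rewrite mulr_suml; apply: eq_bigr => g _.
by rewrite rmorphM mulrC mulrA.
Qed.

End GaloisCoefficients.

(** * Functionals that separate tensors *)
Section SeparatingTensors.

Variables (k : fieldType) (K : fieldExtType k) (H : vectType k) (I : finType).
Variable phi : {linear H -> {ffun I -> K}}.

(** The image of a k-basis of H stays independent over K. This makes the
    K-valued functionals x |-> phi x n separate tensors over k, so that identities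
    in tensor powers of H can be checked on coefficients. *)
Definition lin_disjoint := forall s : 'I_(\dim {:H}) -> K,
  (forall n, \sum_i s i * phi (vbasis {:H})`_i n = 0) -> forall i, s i = 0.

Hypothesis phi_free : lin_disjoint.

Lemma lin_disjoint_inj x : (forall n, phi x n = 0) -> x = 0.
Proof.
move=> phix0; rewrite (coord_vbasis (memvf x)) big1 // => i _.
suff /(_ i)/eqP : forall i, (coord (vbasis {:H}) i x)%:A = 0 :> K.
  by rewrite scaler_eq0 oner_eq0 orbF => /eqP->; rewrite scale0r.
apply: phi_free => n; rewrite -[RHS](phix0 n) {2}(coord_vbasis (memvf x)).
rewrite linear_sum sum_ffunE; apply: eq_bigr => j _.
by rewrite linearZ ffunE mulr_algl.
Qed.

(** Fix j: the K-combination of the phi e_i with coefficients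
    ev_j (sum_l t_il f_l) vanishes, so each of these coefficients does; now use
    that the ev_j separate U. *)
Lemma tensor_separated (U : vectType k) (J : Type) (ev : J -> U -> K)
    (t : tensor H U) :
    (forall j, linear (ev j)) -> (forall u, (forall j, ev j u = 0) -> u = 0) ->
    (forall n j, tlift (fun x u => phi x n * ev j u) t = 0) ->
  t = 0.
Proof.
move=> lin_ev sep_ev t0; apply/matrixP=> i l; rewrite mxE.
suff u0 : \sum_l t i l *: (vbasis {:U})`_l = 0.
  by move/freeP: (basis_free (vbasisP {:U})) => /(_ _ u0).
apply: sep_ev => j; move: i.
pose mL := GRing.isLinear.Build k U K _ (ev j) (lin_ev j).
pose L : {linear U -> K} := HB.pack (ev j) mL.
apply: phi_free => n; rewrite -[RHS](t0 n j); apply: eq_bigr => i _.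
rewrite -[ev j _]/(L _) linear_sum mulr_suml; apply: eq_bigr => m _.
by rewrite linearZ -scalerAl mulrC.
Qed.

Lemma base_tensor_separated (t : tensor K H) :
  (forall n, tlift (fun s x => s * phi x n) t = 0) -> t = 0.
Proof.
move=> t0; apply/matrixP=> i l; rewrite mxE.
suff u0 : \sum_i t i l *: (vbasis {:K})`_i = 0.
  by move/freeP: (basis_free (vbasisP {:K})) => /(_ _ u0).
move: l; apply: phi_free => n; rewrite -[RHS](t0 n) [RHS]exchange_big.
by apply: eq_bigr => j _; rewrite mulr_suml; apply: eq_bigr => m _; rewrite -scalerAl.
Qed.

Definition ev2 m n (t : tensor H H) := tlift (fun x y => phi x m * phi y n) t.

Definition ev3 l m n (t : tensor H (tensor H H)) :=
  tlift (fun x u => phi x l * ev2 m n u) t.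

Lemma eval_linear n : linear (fun x => phi x n).
Proof. by move=> a x y; rewrite linearP !ffunE. Qed.

Lemma ev2_linear m n : linear (ev2 m n).
Proof. exact: tlift_linear. Qed.

Lemma ev3_linear l m n : linear (ev3 l m n).
Proof. exact: tlift_linear. Qed.

Lemma ev2_sub0 t : (forall m n, ev2 m n t = 0) -> t = 0.
Proof.
apply: tensor_separated => [|x]; [exact: eval_linear | exact: lin_disjoint_inj].
Qed.

Lemma ev2_inj t u : (forall m n, ev2 m n t = ev2 m n u) -> t = u.
Proof.
move=> eqtu; apply/eqP; rewrite -subr_eq0; apply/eqP/ev2_sub0 => m n.
by rewrite -scaleN1r addrC ev2_linear eqtu scaleN1r addNr.
Qed.

Lemma ev3_inj t u : (forall l m n, ev3 l m n t = ev3 l m n u) -> t = u.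
Proof.
move=> eqtu; apply/eqP; rewrite -subr_eq0; apply/eqP.
apply: (@tensor_separated _ _ (fun mn => ev2 mn.1 mn.2)).
- by move=> [m n]; apply: ev2_linear.
- by move=> v v0; apply: ev2_sub0 => m n; apply: (v0 (m, n)).
move=> l [m n]; rewrite -[LHS]/(ev3 l m n (t - u)).
by rewrite -scaleN1r addrC ev3_linear eqtu scaleN1r addNr.
Qed.

Lemma mul_linearl (U : vectType k) (f : U -> K) c :
  linear f -> linear (fun x => f x * c).
Proof. by move=> linf a x y; rewrite linf mulrDl scalerAl. Qed.

Lemma mul_linearr (U : vectType k) (f : U -> K) c :
  linear f -> linear (fun x => c * f x).
Proof. by move=> linf a x y; rewrite linf mulrDr scalerAr. Qed.

Lemma ev2_tens m n x y : ev2 m n (tens x y) = phi x m * phi y n.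
Proof.
rewrite /ev2 tlift_tens // => z; [apply: mul_linearl | apply: mul_linearr];
exact: eval_linear.
Qed.

Lemma ev3_tens l m n x u : ev3 l m n (tens x u) = phi x l * ev2 m n u.
Proof.
rewrite /ev3 tlift_tens // => z; first by apply: mul_linearl; exact: eval_linear.
by apply: mul_linearr; exact: ev2_linear.
Qed.

Lemma ev2_tlift (U V : vectType k) m n (f : U -> V -> tensor H H) t :
  ev2 m n (tlift f t) = tlift (fun x y => ev2 m n (f x y)) t.
Proof. by rewrite linear_tlift //; apply: ev2_linear. Qed.

Lemma ev3_tlift (U V : vectType k) l m n (f : U -> V -> tensor H (tensor H H)) t :
  ev3 l m n (tlift f t) = tlift (fun x y => ev3 l m n (f x y)) t.
Proof. by rewrite linear_tlift //; apply: ev3_linear. Qed.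

Lemma eval_tlift (U V : vectType k) n (f : U -> V -> H) t :
  phi (tlift f t) n = tlift (fun x y => phi (f x y) n) t.
Proof. by rewrite (linear_tlift (L := fun x => phi x n)) //; apply: eval_linear. Qed.

End SeparatingTensors.

Lemma tliftMl (k : fieldType) (K : fieldExtType k) (U V : vectType k)
    (f : U -> V -> K) c t :
  tlift (fun x y => f x y * c) t = tlift f t * c.
Proof. by rewrite (linear_tlift (L := fun x => x * c)) //; apply: mul_linearl. Qed.

Lemma tliftMr (k : fieldType) (K : fieldExtType k) (U V : vectType k)
    (f : U -> V -> K) c t :
  tlift (fun x y => c * f x y) t = c * tlift f t.
Proof. by rewrite (linear_tlift (L := fun x => c * x)) //; apply: mul_linearr. Qed.

Lemma tlift_sum (k : fieldType) (U V W : vectType k) (J : Type) (r : seq J)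
    (P : pred J) (f : J -> U -> V -> W) t :
  tlift (fun x y => \sum_(j <- r | P j) f j x y) t =
  \sum_(j <- r | P j) tlift (f j) t.
Proof.
rewrite /tlift [RHS]exchange_big; apply: eq_bigr => i _.
rewrite [RHS]exchange_big; apply: eq_bigr => l _.
by rewrite scaler_sumr.
Qed.

(** * Regular permutation groups and the fixed elements of K[N] *)
Section RegularSubgroup.

Variables (k : fieldType) (K : splittingFieldType k).
Local Notation galG := (gal_of {:K}).
Local Notation perms := {perm galG}.
Implicit Types (m n : perms) (g : galG).

(** The automorphism by which the basis element n of K[N] acts on K. *)
Definition label n : galG := n^-1%g 1%g.

Lemma label1 : label 1 = 1%g.
Proof. by rewrite /label invg1 perm1. Qed.

Lemma lambdaE g x : lambda g x = (x * g)%g.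
Proof. by rewrite permE. Qed.

Lemma labelM m n : label (m * n) = m^-1%g (label n).
Proof. by rewrite /label invMg permM. Qed.

(** The twist by lambda in the fixed algebra is what makes the composition of
    semilinear combinations of automorphisms agree with the product of K[N]. *)
Lemma label_conjM m n : label (m ^ lambda (label n) * n) = (label m * label n)%g.
Proof.
rewrite labelM -conjVg conjgE !permM lambdaE.
suff -> : (lambda (label n))^-1%g (label n) = 1%g by [].
by apply: (canLR (permK _)); rewrite lambdaE mul1g.
Qed.

Variable N : {group perms}.
Hypothesis regN : regular_perm N.

Lemma label_inj : {in N &, injective label}.
Proof.
move=> m n Nm Nn eq_mn; have [n0 [_ uniq_N]] := regN 1%g (label m).
by apply: invg_inj; rewrite -(uniq_N m^-1%g) ?(uniq_N n^-1%g) // groupV.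
Qed.

Lemma label_surj g : exists2 n, n \in N & label n = g.
Proof.
have [n [[Nn n1] _]] := regN 1%g g.
by exists n^-1%g; rewrite ?groupV // /label invgK.
Qed.

(** The inverse of label on N; the default value 1 is never used as N is
    regular. *)
Definition relabel g := odflt 1%g [pick n in N | label n == g].

Lemma mem_relabel g : relabel g \in N.
Proof. by rewrite /relabel; case: pickP => [n /andP[] | _] //=; rewrite group1. Qed.

Lemma relabelK : cancel relabel label.
Proof.
move=> g; rewrite /relabel; case: pickP => [n /andP[_ /eqP] // | noN].
by have [n Nn ng] := label_surj g; have:= noN n; rewrite Nn ng eqxx.
Qed.

Lemma labelK : {in N, cancel label relabel}.
Proof. by move=> n Nn; apply: label_inj; rewrite ?mem_relabel ?relabelK. Qed.

Lemma sum_relabel (F : perms -> K) :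
  \sum_(n in N) F n = \sum_g F (relabel g).
Proof.
rewrite (reindex relabel); last first.
  by exists label => [g _ | n Nn]; [apply: relabelK | apply: labelK].
by apply: eq_bigl => g; rewrite mem_relabel.
Qed.

Definition supported (c : {ffun perms -> K}) := forall n, n \notin N -> c n = 0.

Definition equivariant (c : {ffun perms -> K}) :=
  forall g n, c (n ^ lambda g)%g = g (c n).

(** The endomorphism of K by which an element of K[N] acts. *)
Definition permact (c : {ffun perms -> K}) : 'End(K) :=
  \sum_(n in N) (amull (c n) \o (label n : 'End(K)))%VF.

Lemma permactE c x : permact c x = \sum_(n in N) c n * label n x.
Proof.
rewrite sum_lfunE; apply: eq_bigr => n _.
by rewrite comp_lfunE lfunE.
Qed.

(** Since label is a bijection from N to G, an endomorphism has well-defined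
    coefficients on N: permcoef inverts permact. *)
Definition permcoef (F : 'End(K)) : {ffun perms -> K} :=
  [ffun n => if n \in N then gcoef (label n) F else 0].

Lemma permcoef_linear : linear permcoef.
Proof.
move=> a F F'; apply/ffunP=> n; rewrite !ffunE.
by case: ifP => _; rewrite ?gcoef_linear // scaler0 addr0.
Qed.
HB.instance Definition _ :=
  GRing.isLinear.Build k 'End(K) {ffun perms -> K} _ permcoef permcoef_linear.

Lemma permcoef_supported F : supported (permcoef F).
Proof. by move=> n notNn; rewrite ffunE (negPf notNn). Qed.

Lemma permcoef_unique c (F : 'End(K)) : supported c ->
  (forall x, F x = \sum_(n in N) c n * label n x) -> permcoef F = c.
Proof.
move=> suppc Fc; apply/ffunP=> n; rewrite ffunE.
case: ifPn => [Nn | /suppc-> //].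
rewrite -{2}(labelK Nn); apply: (gcoef_unique (c := fun g => c (relabel g))) => x.
by rewrite Fc sum_relabel; apply: eq_bigr => g _; rewrite relabelK.
Qed.

Lemma permactK c : supported c -> permcoef (permact c) = c.
Proof. by move=> suppc; apply: permcoef_unique => // x; apply: permactE. Qed.

Hypothesis galK : galois 1 {:K}.

Lemma permcoefE (F : 'End(K)) x : F x = \sum_(n in N) permcoef F n * label n x.
Proof.
rewrite (gcoefE galK) sum_relabel; apply: eq_bigr => g _.
by rewrite ffunE mem_relabel relabelK.
Qed.

Lemma permcoef_inj : injective permcoef.
Proof. by move=> F F' eqF; apply/lfunP=> x; rewrite !permcoefE eqF. Qed.

Hypothesis normN : lambda_normalized N.

Lemma memJ_lambda n g : (n ^ lambda g \in N)%g = (n \in N).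
Proof. by rewrite memJ_norm. Qed.

(** The linear map whose kernel consists of the endomorphisms with equivariant
    coefficients; it presents the fixed elements of K[N] as a subspace. *)
Definition defect (F : 'End(K)) : {ffun galG * perms -> K} :=
  [ffun gn => permcoef F (gn.2 ^ lambda gn.1)%g - gn.1 (permcoef F gn.2)].

Lemma defect_linear : linear defect.
Proof.
move=> a F F'; apply/ffunP=> gn; rewrite [LHS]ffunE permcoef_linear !ffunE.
by rewrite linearP scalerBr opprD addrACA.
Qed.
HB.instance Definition _ :=
  GRing.isLinear.Build k 'End(K) {ffun galG * perms -> K} _ defect defect_linear.

Definition descent_space : {vspace 'End(K)} := lker (linfun defect).

Lemma descentP F : reflect (equivariant (permcoef F)) (F \in descent_space).
Proof.
rewrite memv_ker lfunE; apply: (iffP eqP) => [/ffunP eqv g n | eqv].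
  have: defect F (g, n) = 0 by rewrite eqv ffunE.
  by rewrite ffunE => /eqP; rewrite subr_eq0 => /eqP.
by apply/ffunP=> [[g n]]; rewrite [LHS]ffunE [RHS]ffunE /= eqv subrr.
Qed.

Lemma permact_descent c : supported c -> equivariant c -> permact c \in descent_space.
Proof. by move=> suppc eqvc; apply/descentP; rewrite permactK. Qed.

Lemma permcoef1 : permcoef \1%VF = [ffun n => (n == 1%g)%:R].
Proof.
apply: permcoef_unique => [n notNn | x].
  by rewrite ffunE; case: eqP notNn => // ->; rewrite group1.
rewrite (bigD1 1%g) //= big1 ?addr0 => [|n /andP[_ n1]].
  by rewrite ffunE eqxx mul1r label1 gal_id id_lfunE.
by rewrite ffunE (negPf n1) mul0r.
Qed.

Lemma descent1 : \1%VF \in descent_space.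
Proof.
apply/descentP; rewrite permcoef1 => g n; rewrite !ffunE -(conj1g (lambda g)).
by rewrite (inj_eq (conjg_inj _)) rmorph_nat conj1g.
Qed.

Definition convolution (c d : {ffun perms -> K}) : {ffun perms -> K} :=
  [ffun n => \sum_(m in N) \sum_(m' in N | n == (m' * m)%g) c m * d m'].

(** The coefficients of F' become twisted by label m when F' is composed with
    the term of F at m; equivariance turns the twist into a conjugation of the
    index, and label_conjM identifies the resulting automorphism. *)
Lemma permcoef_comp F F' : equivariant (permcoef F') ->
  permcoef (F \o F')%VF = convolution (permcoef F) (permcoef F').
Proof.
move=> eqvF'; apply: permcoef_unique => [n notNn | x].
  rewrite ffunE big1 // => m Nm; rewrite big_pred0 // => m'.
  by apply: contraNF notNn => /andP[Nm' /eqP->]; rewrite groupM.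
rewrite comp_lfunE (permcoefE F) (permcoefE F').
rewrite [RHS](eq_bigr (fun n => \sum_(m in N) \sum_(m' in N)
    if n == (m' * m)%g then permcoef F m * permcoef F' m' * label n x else 0));
  last first.
  move=> n _; rewrite [convolution _ _ _]ffunE mulr_suml; apply: eq_bigr => m _.
  by rewrite mulr_suml big_mkcondr.
rewrite [RHS]exchange_big; apply: eq_bigr => m Nm /=.
rewrite [RHS]exchange_big rmorph_sum mulr_sumr /=.
rewrite [RHS](reindex_inj (conjg_inj (lambda (label m)))) /=.
apply: eq_big => n' => [|Nn']; first by rewrite memJ_lambda.
rewrite -big_mkcondr (big_pred1 (n' ^ lambda (label m) * m)%g) => [|n] /=.
  by rewrite label_conjM galMf eqvF' rmorphM mulrA.
by case: eqP => [->|_]; rewrite ?andbF // groupM ?memJ_lambda.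
Qed.

Lemma descent_comp F F' : F \in descent_space -> F' \in descent_space ->
  (F \o F')%VF \in descent_space.
Proof.
move=> /descentP eqvF /descentP eqvF'; apply/descentP=> g n.
rewrite permcoef_comp // 2![convolution _ _ _]ffunE rmorph_sum /=.
rewrite [LHS](reindex_inj (conjg_inj (lambda g))) /=.
apply: eq_big => m => [|Nm]; first by rewrite memJ_lambda.
rewrite rmorph_sum /= [LHS](reindex_inj (conjg_inj (lambda g))) /=.
apply: eq_big => m' => [|_]; last by rewrite eqvF eqvF' rmorphM.
by rewrite memJ_lambda -conjMg (inj_eq (conjg_inj _)).
Qed.

End RegularSubgroup.

(** * The algebra K[N]^G, as a subalgebra of End_k(K) *)
Section DescentAlgebra.

Variables (k : fieldType) (K : splittingFieldType k).
Local Notation galG := (gal_of {:K}).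
Local Notation perms := {perm galG}.

(** The hypotheses on N are bundled so that the algebra structures below can be
    attached to a type that depends on a single argument. *)
Record gp_subgroup := GpSubgroup {
  gp_group :> {group perms};
  gp_regular : regular_perm gp_group;
  gp_normalized : lambda_normalized gp_group;
  gp_galois : galois 1 {:K}
}.

Variable N : gp_subgroup.

Definition descent_alg : predArgType := subvs_of (descent_space N).

HB.instance Definition _ := Vector.copy descent_alg (subvs_of (descent_space N)).

Definition descent_val (h : descent_alg) : 'End(K) := vsval h.
Lemma descent_val_linear : linear descent_val.
Proof. exact: (linearP (vsval : subvs_of (descent_space N) -> 'End(K))). Qed.
HB.instance Definition _ := GRing.isLinear.Build k descent_alg 'End(K) _
  descent_val descent_val_linear.

Definition to_descent (F : 'End(K)) : descent_alg := vsproj (descent_space N) F.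
Lemma to_descent_linear : linear to_descent.
Proof. exact: (linearP (vsproj (descent_space N))). Qed.
HB.instance Definition _ := GRing.isLinear.Build k 'End(K) descent_alg _
  to_descent to_descent_linear.

Lemma descent_valP h : descent_val h \in descent_space N.
Proof. exact: subvsP. Qed.

Lemma descent_val_inj : injective descent_val.
Proof. exact: subvs_inj. Qed.

Lemma to_descentK F : F \in descent_space N -> descent_val (to_descent F) = F.
Proof. exact: vsprojK. Qed.

Definition descent_one : descent_alg := to_descent \1%VF.
Definition descent_mul (g h : descent_alg) : descent_alg :=
  to_descent (descent_val g \o descent_val h)%VF.

Lemma descent_val1 : descent_val descent_one = \1%VF.
Proof. by rewrite to_descentK // descent1 //; apply: gp_regular. Qed.

Lemma descent_valM g h :
  descent_val (descent_mul g h) = (descent_val g \o descent_val h)%VF.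
Proof.
rewrite to_descentK // descent_comp ?descent_valP //.
- exact: gp_regular.
- exact: gp_galois.
exact: gp_normalized.
Qed.

Lemma descent_mulA : associative descent_mul.
Proof. by move=> f g h; apply: descent_val_inj; rewrite !descent_valM comp_lfunA. Qed.

Lemma descent_mul1l : left_id descent_one descent_mul.
Proof.
by move=> f; apply: descent_val_inj; rewrite descent_valM descent_val1 comp_lfun1l.
Qed.

Lemma descent_mul1r : right_id descent_one descent_mul.
Proof.
by move=> f; apply: descent_val_inj; rewrite descent_valM descent_val1 comp_lfun1r.
Qed.

Lemma descent_mulDl : left_distributive descent_mul +%R.
Proof.
move=> f g h; apply: descent_val_inj; rewrite raddfD /= !descent_valM raddfD.
exact: comp_lfunDl.
Qed.

Lemma descent_mulDr : right_distributive descent_mul +%R.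
Proof.
move=> f g h; apply: descent_val_inj; rewrite raddfD /= !descent_valM raddfD.
exact: comp_lfunDr.
Qed.

Lemma descent_one_neq0 : descent_one != 0.
Proof.
apply/eqP => /(congr1 descent_val); rewrite descent_val1 linear0.
move/lfunP/(_ 1); rewrite !lfunE /= => /eqP; exact/negP/oner_neq0.
Qed.

HB.instance Definition _ := GRing.Zmodule_isNzRing.Build descent_alg
  descent_mulA descent_mul1l descent_mul1r descent_mulDl descent_mulDr
  descent_one_neq0.

Lemma descent_scaleAl a (f g : descent_alg) : a *: (f * g) = (a *: f) * g.
Proof.
apply: descent_val_inj; rewrite linearZ /= !descent_valM linearZ.
by rewrite comp_lfunZl.
Qed.
HB.instance Definition _ :=
  GRing.Lmodule_isLalgebra.Build k descent_alg descent_scaleAl.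

Lemma descent_scaleAr a (f g : descent_alg) : a *: (f * g) = f * (a *: g).
Proof.
apply: descent_val_inj; rewrite linearZ /= !descent_valM linearZ.
by rewrite comp_lfunZr.
Qed.
HB.instance Definition _ :=
  GRing.Lalgebra_isAlgebra.Build k descent_alg descent_scaleAr.

HB.instance Definition _ := Algebra_isFalgebra.Build k descent_alg.

End DescentAlgebra.
(** * The Hopf algebra K[N]^G and its Hopf Galois structure *)
Section DescentHopf.

Variables (k : fieldType) (K : splittingFieldType k) (N : gp_subgroup K).
Local Notation galG := (gal_of {:K}).
Local Notation perms := {perm galG}.
Local Notation H := (descent_alg N).
Local Notation e := (vbasis {:H}).
Let regN : regular_perm N := gp_regular N.
Let normN : lambda_normalized N := gp_normalized N.
Let galK : galois 1 {:K} := gp_galois N.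

(** The embedding of the fixed algebra in K[N]. *)
Definition coefs (h : H) : {ffun perms -> K} := permcoef N (descent_val h).

Lemma coefs_is_linear : linear coefs.
Proof. by move=> a g h; rewrite /coefs !linearP. Qed.
HB.instance Definition _ :=
  GRing.isLinear.Build k H {ffun perms -> K} _ coefs coefs_is_linear.

Lemma coefs_inj : injective coefs.
Proof.
by move=> g h /(permcoef_inj regN galK); apply: descent_val_inj.
Qed.

Lemma coefs_supported h : supported N (coefs h).
Proof. exact: permcoef_supported. Qed.

Lemma coefs_equivariant h : equivariant (coefs h).
Proof. exact/descentP/descent_valP. Qed.

Definition of_coef (c : {ffun perms -> K}) : H := to_descent N (permact N c).

Lemma of_coefK c : supported N c -> equivariant c -> coefs (of_coef c) = c.
Proof.
move=> suppc eqvc; rewrite /coefs to_descentK ?permactK //.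
exact: permact_descent.
Qed.

Lemma lambdaM g h : lambda (g * h)%g = (lambda g * lambda h)%g :> perms.
Proof. by apply/permP=> x; rewrite permM !lambdaE mulgA. Qed.

(** Multiply a relation sum_i s_i e_i = 0 by w_j and add its conjugates: as the
    e_i are equivariant, this gives a relation with coefficients tr (w_j s_i) in
    k, which vanish; then s_i = 0 by gtraceE. *)
Lemma coefs_lin_disjoint : lin_disjoint coefs.
Proof.
move=> s s0 i; rewrite [s i]gtraceE big1 // => j _.
suff /(_ i) : forall i, kcoord (gtrace (tnth (gbasis K) j * s i)) = 0.
  move=> tr0; rewrite -(gal_fixed_alg galK (fun g => gtrace_fixed g _)) tr0.
  by rewrite scale0r mulr0.
move/freeP: (basis_free (vbasisP {:H})); apply; apply: coefs_inj.
apply/ffunP=> n; rewrite linear_sum sum_ffunE linear0 ffunE.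
pose S g := \sum_i tnth (gbasis K) j * s i * coefs e`_i (n ^ (lambda g)^-1)%g.
transitivity (\sum_(g : galG) g (S g)); last first.
  rewrite big1 // => g _; rewrite /S.
  under eq_bigr => i' _ do rewrite -mulrA.
  by rewrite -mulr_sumr s0 mulr0 rmorph0.
under [RHS]eq_bigr => g _ do rewrite rmorph_sum.
rewrite exchange_big; apply: eq_bigr => i' _.
rewrite linearZ ffunE -mulr_algl gal_fixed_alg //; last first.
  by move=> g; apply: gtrace_fixed.
rewrite mulr_suml; apply: eq_bigr => g _.
by rewrite [in RHS]rmorphM /= -coefs_equivariant conjgKV.
Qed.

(** The trace over G of w_j times the basis element m of K[N]. *)
Definition delta_trace (j : 'I_#|[set: galG]|) (m : perms) : {ffun perms -> K} :=
  [ffun n => \sum_(g : galG) if (m ^ lambda g)%g == n then g (tnth (gbasis K) j)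
                             else 0].

Lemma delta_trace_supported j m : m \in N -> supported N (delta_trace j m).
Proof.
move=> Nm n notNn; rewrite ffunE big1 // => g _.
by case: eqP notNn => // <-; rewrite memJ_lambda // Nm.
Qed.

Lemma delta_trace_equivariant j m : equivariant (delta_trace j m).
Proof.
move=> h n; rewrite !ffunE rmorph_sum (reindex_inj (mulIg h)).
apply: eq_bigr => g _ /=.
rewrite lambdaM conjgM (inj_eq (conjg_inj _)) galMf.
by case: ifP => // _; rewrite rmorph0.
Qed.

(** The coordinates over K of the basis element m of K[N] with respect to a
    k-basis of the fixed algebra, which is therefore a K-basis of K[N]. *)
Definition dual_coef i (m : perms) : K :=
  \sum_j gdual j * (coord e i (of_coef (delta_trace j m)))%:A.

Lemma dual_coefK m n : m \in N -> \sum_i dual_coef i m * coefs e`_i n = (m == n)%:R.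
Proof.
move=> Nm; rewrite /dual_coef; under eq_bigr => i _ do rewrite mulr_suml.
rewrite exchange_big /=.
transitivity (\sum_j gdual j * delta_trace j m n).
  apply: eq_bigr => j _; under eq_bigr => i _ do rewrite -mulrA.
  rewrite -mulr_sumr; congr (_ * _).
  rewrite -{2}(of_coefK (delta_trace_supported j Nm) (delta_trace_equivariant j m)).
  rewrite {2}(coord_vbasis (memvf (of_coef _))) linear_sum sum_ffunE.
  by apply: eq_bigr => i _; rewrite linearZ [RHS]ffunE mulr_algl.
under eq_bigr => j _ do rewrite ffunE mulr_sumr.
rewrite exchange_big (bigD1 1%g) //= [X in _ + X]big1 ?addr0 => [|g g1].
  have -> : lambda (1%g : galG) = 1%g.
    by apply/permP=> x; rewrite lambdaE mulg1 perm1.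
  rewrite conjg1; case: eqP => _; last by rewrite big1 // => j _; rewrite mulr0.
  under eq_bigr => j _ do rewrite mulrC.
  by rewrite gdualP eqxx.
case: eqP => _; last by rewrite big1 // => j _; rewrite mulr0.
under eq_bigr => j _ do rewrite mulrC.
by rewrite gdualP (negPf g1).
Qed.

Lemma dual_coef_equivariant i m g : m \in N -> dual_coef i (m ^ lambda g)%g = g (dual_coef i m).
Proof.
move=> Nm; apply/eqP; rewrite -subr_eq0; apply/eqP; move: i.
apply: coefs_lin_disjoint => n.
under eq_bigr => i _ do rewrite mulrBl.
rewrite sumrB dual_coefK ?memJ_lambda //.
rewrite -[n](conjgKV (lambda g)).
under eq_bigr => i _ do rewrite coefs_equivariant -rmorphM.
rewrite -rmorph_sum /= dual_coefK // rmorph_nat (inj_eq (conjg_inj _)).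
by rewrite subrr.
Qed.

(** The restriction of the comultiplication n |-> n (x) n of K[N]. The sums are
    fixed by G, so kcoord loses nothing. *)
Definition descent_comul (h : H) : tensor H H :=
  \matrix_(i, j) kcoord (\sum_(l in N) dual_coef i l * dual_coef j l * coefs h l).

Lemma descent_comul_linear : linear descent_comul.
Proof.
move=> a g h; apply/matrixP=> i j; rewrite !mxE -kcoord_linear; congr kcoord.
rewrite scaler_sumr -big_split; apply: eq_bigr => l _ /=.
by rewrite linearP !ffunE mulrDr scalerAr.
Qed.
HB.instance Definition _ := GRing.isLinear.Build k H (tensor H H) _
  descent_comul descent_comul_linear.

Lemma ev2_comul m n h :
  ev2 coefs m n (descent_comul h) = if m == n then coefs h n else 0.
Proof.
have ev0 (f : H -> H -> K) t : (forall x y, f x y = 0) -> tlift f t = 0.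
  by move=> f0; rewrite /tlift big1 // => i _; rewrite big1 // => j _; rewrite f0 scaler0.
have [Nn | notNn] := boolP (n \in N); last first.
  rewrite coefs_supported // if_same; apply: ev0 => x y.
  by rewrite [coefs y n]coefs_supported // mulr0.
have [Nm | notNm] := boolP (m \in N); last first.
  rewrite ifN; last by apply: contraNneq notNm => ->.
  by apply: ev0 => x y; rewrite [coefs x m]coefs_supported // mul0r.
pose S := \sum_(l in N) (l == m)%:R * (l == n)%:R * coefs h l.
transitivity S; last first.
  rewrite /S (bigD1 n) //= big1 ?addr0 => [|l /andP[_ /negPf->]].
    by rewrite eqxx mulr1 eq_sym; case: ifP => _; rewrite ?mul1r ?mul0r.
  by rewrite mulr0 mul0r.
transitivity (\sum_i \sum_j \sum_(l in N)
    dual_coef i l * dual_coef j l * coefs h l * (coefs e`_i m * coefs e`_j n)).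
  apply: eq_bigr => i _; apply: eq_bigr => j _.
  rewrite mxE -mulr_algl gal_fixed_alg ?mulr_suml // => g.
  rewrite rmorph_sum [RHS](reindex_inj (conjg_inj (lambda g))) /=.
  apply: eq_big => l => [|Nl]; first by rewrite memJ_lambda.
  by rewrite !rmorphM /= coefs_equivariant !dual_coef_equivariant.
under eq_bigr => i _ do rewrite exchange_big.
rewrite exchange_big; apply: eq_bigr => l Nl /=.
rewrite -!dual_coefK // !mulr_suml; apply: eq_bigr => i _.
rewrite mulr_sumr mulr_suml; apply: eq_bigr => j _.
by rewrite mulrAC mulrACA.
Qed.

Lemma coefs1 : coefs 1 = [ffun n => (n == 1%g)%:R].
Proof. by rewrite /coefs descent_val1 permcoef1. Qed.

Lemma coefsM g h : coefs (g * h) = convolution N (coefs g) (coefs h).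
Proof.
rewrite /coefs descent_valM permcoef_comp //.
exact: (coefs_equivariant h).
Qed.

Lemma coefs1E n : coefs 1 n = (n == 1%g)%:R.
Proof. by rewrite coefs1 [LHS]ffunE. Qed.

(** The form of the product that composes well with the diagonal
    comultiplication. *)
Lemma coefsME g h n :
  coefs (g * h) n = \sum_(m in N) coefs g (m^-1 * n)%g * coefs h m.
Proof.
rewrite coefsM [LHS]ffunE; under eq_bigr => m _ do rewrite big_mkcondr.
rewrite exchange_big; apply: eq_bigr => m Nm.
rewrite -big_mkcondr; have [Nmn | notNmn] := boolP ((m^-1 * n)%g \in N).
  rewrite (big_pred1 (m^-1 * n)%g) // => m' /=.
  by apply/andP/eqP => [[_ /eqP->] | ->]; rewrite ?mulKg // mulKVg.
rewrite [coefs g (_ * _)%g]coefs_supported // mul0r big_pred0 // => m'.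
by apply: contraNF notNmn => /andP[Nm' /eqP->]; rewrite mulKg.
Qed.

Definition descent_counit (h : H) : k^o := kcoord (\sum_(n in N) coefs h n).

Lemma descent_counit_linear : linear descent_counit.
Proof.
move=> a g h; suff : kcoord (\sum_(n in N) coefs (a *: g + h) n) =
  a * kcoord (\sum_(n in N) coefs g n) + kcoord (\sum_(n in N) coefs h n) by [].
rewrite -kcoord_linear; congr kcoord.
rewrite scaler_sumr -big_split; apply: eq_bigr => n _.
exact: eval_linear.
Qed.
HB.instance Definition _ := GRing.isLinear.Build k H k^o _
  descent_counit descent_counit_linear.

Lemma descent_counitE h : (descent_counit h : k)%:A = \sum_(n in N) coefs h n.
Proof.
apply: gal_fixed_alg => // g.
rewrite rmorph_sum [RHS](reindex_inj (conjg_inj (lambda g))) /=.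
by apply: eq_big => n => [|_]; rewrite ?memJ_lambda ?coefs_equivariant.
Qed.

Definition inverted (h : H) : {ffun perms -> K} := [ffun n => coefs h n^-1%g].

Lemma inverted_supported h : supported N (inverted h).
Proof. by move=> n notNn; rewrite ffunE coefs_supported ?groupV. Qed.

Lemma inverted_equivariant h : equivariant (inverted h).
Proof. by move=> g n; rewrite 2![inverted _ _]ffunE -conjVg coefs_equivariant. Qed.

Definition descent_antipode (h : H) : H := of_coef (inverted h).

Lemma coefs_antipode h n : coefs (descent_antipode h) n = coefs h n^-1%g.
Proof.
rewrite of_coefK; first by rewrite [LHS]ffunE.
  exact: inverted_supported.
exact: inverted_equivariant.
Qed.

Lemma descent_antipode_linear : linear descent_antipode.
Proof.
move=> a g h; apply: coefs_inj; apply/ffunP=> n.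
by rewrite coefs_antipode !eval_linear !coefs_antipode.
Qed.
HB.instance Definition _ := GRing.isLinear.Build k H H _
  descent_antipode descent_antipode_linear.

(** The comultiplication is diagonal in the coordinates on K[N]. *)
Lemma tlift_comul_double_sum (c : perms -> perms -> K) h :
  tlift (fun x y => \sum_(m in N) \sum_(n in N) c m n * (coefs x m * coefs y n))
    (descent_comul h) = \sum_(n in N) c n n * coefs h n.
Proof.
rewrite tlift_sum; apply: eq_bigr => m Nm.
rewrite tlift_sum (bigD1 m) //= big1 ?addr0 => [|n /andP[_ nm]].
  by rewrite tliftMr -/(ev2 _ _ _ _) ev2_comul eqxx.
by rewrite tliftMr -/(ev2 _ _ _ _) ev2_comul eq_sym (negPf nm) mulr0.
Qed.

(** Both sides take the value coefs h n on the diagonal l = m = n and vanish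
    elsewhere. *)
Lemma descent_comulA h :
  tlift (fun x y => tlift (fun a b => tens a (tens b y)) (descent_comul x))
    (descent_comul h)
  = tlift (fun x y => tens x (descent_comul y)) (descent_comul h).
Proof.
apply: (ev3_inj coefs_lin_disjoint) => l m n; rewrite !ev3_tlift.
transitivity (tlift (fun x y => (l == m)%:R * (coefs x m * coefs y n))
    (descent_comul h)).
  apply: eq_tlift => x y; rewrite ev3_tlift.
  transitivity (ev2 coefs l m (descent_comul x) * coefs y n).
    rewrite -tliftMl; apply: eq_tlift => a b.
    by rewrite ev3_tens ev2_tens mulrA.
  by rewrite ev2_comul mulrA; case: eqP => _; rewrite ?mul1r ?mul0r.
transitivity (tlift (fun x y => coefs x l * ev2 coefs m n (descent_comul y))
    (descent_comul h)); last by apply: eq_tlift => x y; rewrite ev3_tens.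
under [RHS]eq_tlift => x y do rewrite ev2_comul.
rewrite tliftMr -/(ev2 _ _ _ _) ev2_comul.
case: (m =P n) => [-> | _]; last first.
  under eq_tlift => x y do rewrite mulr0 -[0](mulr0 0).
  by rewrite tliftMr mul0r mulr0.
by rewrite -/(ev2 _ _ _ _) ev2_comul; case: eqP => _; rewrite ?mul1r ?mul0r.
Qed.

Lemma descent_counitl h :
  tlift (fun x y => descent_counit x *: y) (descent_comul h) = h.
Proof.
apply: coefs_inj; apply/ffunP=> n; rewrite eval_tlift.
transitivity (tlift (fun x y => \sum_(m in N) coefs x m * coefs y n)
    (descent_comul h)).
  apply: eq_tlift => x y; rewrite linearZ [LHS]ffunE.
  by rewrite -mulr_algl descent_counitE mulr_suml.
rewrite tlift_sum; under eq_bigr => m _ do rewrite -/(ev2 _ _ _ _) ev2_comul.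
rewrite -big_mkcondr /=; have [Nn | notNn] := boolP (n \in N).
  rewrite (big_pred1 n) // => m /=.
  by case: eqP => [->|_]; rewrite ?andbF ?Nn.
rewrite big_pred0 ?coefs_supported // => m.
by case: eqP => [->|_]; rewrite ?andbF ?(negPf notNn).
Qed.

Lemma descent_comulC h :
  tlift (fun x y => tens y x) (descent_comul h) = descent_comul h.
Proof.
apply: (ev2_inj coefs_lin_disjoint) => m n; rewrite ev2_tlift.
under eq_tlift => x y do rewrite ev2_tens mulrC.
by rewrite -/(ev2 _ _ _ _) !ev2_comul eq_sym; case: eqP => [->|].
Qed.

Lemma descent_counitr h :
  tlift (fun x y => descent_counit y *: x) (descent_comul h) = h.
Proof.
rewrite -{2}[h]descent_counitl -{2}[descent_comul h]descent_comulC.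
rewrite (linear_tlift (L := tlift _)); last exact: tlift_linear.
apply: eq_tlift => x y; rewrite tlift_tens // => z a b c.
  by rewrite linearP scalerDl scalerA.
by rewrite linearP /= scalerA mulrC -scalerA.
Qed.

Lemma descent_comul1 : descent_comul 1 = tens 1 1.
Proof.
apply: (ev2_inj coefs_lin_disjoint) => m n; rewrite ev2_comul ev2_tens !coefs1E.
case: (m =P n) => [->|/eqP mn]; first by case: eqP; rewrite ?mul1r ?mul0r.
case: (m =P 1%g) mn => [-> | _ _]; last by rewrite mul0r.
by rewrite eq_sym => /negPf->; rewrite mulr0.
Qed.

Lemma descent_comulM g h : descent_comul (g * h) =
  tlift (fun a b => tlift (fun c d => tens (a * c) (b * d)) (descent_comul h))
    (descent_comul g).
Proof.
apply: (ev2_inj coefs_lin_disjoint) => p q; rewrite ev2_comul ev2_tlift.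
transitivity (tlift (fun a b => \sum_(m in N)
    (coefs a (m^-1 * p)%g * coefs b (m^-1 * q)%g) * coefs h m) (descent_comul g)).
  rewrite tlift_sum; under eq_bigr => m _ do
    rewrite tliftMl -/(ev2 _ _ _ _) ev2_comul (inj_eq (mulgI _)).
  case: eqP => _; first exact: coefsME.
  by rewrite big1 // => m _; rewrite mul0r.
apply: eq_tlift => a b; rewrite ev2_tlift.
rewrite -(tlift_comul_double_sum
  (fun m n => coefs a (m^-1 * p)%g * coefs b (n^-1 * q)%g)).
apply: eq_tlift => c d; rewrite ev2_tens !coefsME mulr_suml.
apply: eq_bigr => m _; rewrite mulr_sumr; apply: eq_bigr => n _.
by rewrite mulrACA.
Qed.

(** All automorphisms fix 1. *)
Lemma descent_counit_val h : (descent_counit h : k)%:A = descent_val h 1.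
Proof.
rewrite descent_counitE (permcoefE regN galK).
by apply: eq_bigr => n _; rewrite rmorph1 mulr1.
Qed.

Lemma descent_counit1 : descent_counit 1 = 1.
Proof.
rewrite -[RHS](@kcoord_alg _ K) -[LHS](@kcoord_alg _ K); congr (kcoord _ : k).
by rewrite descent_counit_val descent_val1 id_lfunE scale1r.
Qed.

Lemma descent_counitM g h :
  descent_counit (g * h) = descent_counit g * descent_counit h.
Proof.
rewrite -[RHS](@kcoord_alg _ K) -[LHS](@kcoord_alg _ K); congr (kcoord _ : k).
rewrite descent_counit_val descent_valM comp_lfunE -descent_counit_val linearZ.
by rewrite /= -descent_counit_val scalerA mulrC.
Qed.

Lemma coefs_counit_alg h n :
  coefs ((descent_counit h : k)%:A : H) n = (n == 1%g)%:R * \sum_(m in N) coefs h m.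
Proof.
by rewrite linearZ [LHS]ffunE coefs1E -mulr_algl descent_counitE mulrC.
Qed.

Lemma descent_antipodel h :
  tlift (fun x y => descent_antipode x * y) (descent_comul h) =
  (descent_counit h : k)%:A.
Proof.
apply: coefs_inj; apply/ffunP=> n; rewrite eval_tlift coefs_counit_alg.
under eq_tlift => x y do rewrite coefsME.
rewrite tlift_sum mulr_sumr; apply: eq_bigr => m _.
under eq_tlift => x y do rewrite coefs_antipode invMg invgK.
rewrite -/(ev2 _ _ _ _) ev2_comul -{2}[m]mul1g (inj_eq (mulIg _)) eq_invg_sym invg1.
by rewrite eq_sym; case: eqP => _; rewrite ?mul1r ?mul0r.
Qed.

Lemma descent_antipoder h :
  tlift (fun x y => x * descent_antipode y) (descent_comul h) =
  (descent_counit h : k)%:A.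
Proof.
apply: coefs_inj; apply/ffunP=> n; rewrite eval_tlift coefs_counit_alg.
under eq_tlift => x y do rewrite coefsME.
rewrite tlift_sum mulr_sumr [RHS](reindex_inj invg_inj) /=.
apply: eq_big => m; first by rewrite groupV.
move=> _; under eq_tlift => x y do rewrite coefs_antipode.
rewrite -/(ev2 _ _ _ _) ev2_comul -{2}[m^-1%g]mulg1 (inj_eq (mulgI _)).
by case: eqP => _; rewrite ?mul1r ?mul0r.
Qed.

Definition descent_hopf : hopfAlgebra k := HopfAlgebra
  descent_comulA descent_counitl descent_counitr descent_comul1 descent_comulM
  descent_counit1 descent_counitM descent_antipodel descent_antipoder
  descent_comulC.

Lemma descent_act_mul h x y :
  descent_val h (x * y) =
  tlift (fun a b => descent_val a x * descent_val b y) (descent_comul h).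
Proof.
rewrite (permcoefE regN galK).
transitivity (tlift (fun a b => \sum_(m in N) \sum_(n in N)
  (label m x * label n y) * (coefs a m * coefs b n)) (descent_comul h)).
  rewrite tlift_comul_double_sum; apply: eq_bigr => n _.
  by rewrite rmorphM mulrC.
apply: eq_tlift => a b; rewrite !(permcoefE regN galK) mulr_suml.
apply: eq_bigr => m _; rewrite mulr_sumr; apply: eq_bigr => n _.
by rewrite mulrC [RHS]mulrACA.
Qed.

(** The map K (x) H -> End_k(K) that has to be bijective. *)
Definition base_act (t : tensor K H) : 'End(K) :=
  tlift (fun s h => (amull s \o descent_val h)%VF) t.

Lemma lfun_eval_linear x : linear (fun F : 'End(K) => F x).
Proof. by move=> a F F'; rewrite add_lfunE scale_lfunE. Qed.

Lemma base_actE t x :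
  base_act t x = \sum_(n in N) tlift (fun s h => s * coefs h n) t * label n x.
Proof.
rewrite (linear_tlift (L := fun F : 'End(K) => F x)); last exact: lfun_eval_linear.
transitivity (tlift (fun s h => \sum_(n in N) s * coefs h n * label n x) t).
  apply: eq_tlift => s h; rewrite comp_lfunE lfunE /= (permcoefE regN galK).
  by rewrite mulr_sumr; apply: eq_bigr => n _; rewrite mulrA.
by rewrite tlift_sum; apply: eq_bigr => n _; rewrite tliftMl.
Qed.

(** The automorphisms are independent, so the kernel consists of the tensors
    killed by all coefficients, and these separate tensors. *)
Lemma base_act_inj : injective base_act.
Proof.
move=> t u eq_tu; apply/eqP; rewrite -subr_eq0; apply/eqP.
apply: (base_tensor_separated coefs_lin_disjoint) => n.
pose c : {ffun perms -> K} := [ffun n => tlift (fun s h => s * coefs h n) (t - u)].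
have suppc : supported N c.
  move=> m notNm; rewrite ffunE /tlift big1 // => i _; rewrite big1 // => j _.
  by rewrite coefs_supported // mulr0 scaler0.
suff : c = 0 by move/ffunP/(_ n); rewrite !ffunE.
rewrite -(permcoef_unique regN suppc (F := 0)) => [|x].
  by rewrite linear0.
have -> : (0 : 'End(K)) = base_act (t - u).
  by rewrite -scaleN1r addrC /base_act tlift_linear -!/(base_act _) eq_tu scaleN1r addNr.
by rewrite base_actE; apply: eq_bigr => m _; rewrite [c m]ffunE.
Qed.

(** Expand the coefficients of F in the K-basis of K[N] that comes from H. *)
Definition base_act_inv (F : 'End(K)) : tensor K H :=
  \matrix_(l, i) coord (vbasis {:K}) l (\sum_(m in N) permcoef N F m * dual_coef i m).

Lemma base_act_invK F : base_act (base_act_inv F) = F.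
Proof.
apply/lfunP=> x; rewrite base_actE (permcoefE regN galK).
apply: eq_bigr => n Nn; congr (_ * _).
transitivity (\sum_i (\sum_(m in N) permcoef N F m * dual_coef i m) * coefs e`_i n).
  rewrite [LHS]exchange_big; apply: eq_bigr => i _.
  rewrite {1}(coord_vbasis (memvf (\sum_(m in N) _))) mulr_suml.
  by apply: eq_bigr => l _; rewrite mxE scalerAl.
under eq_bigr => i _ do rewrite mulr_suml.
rewrite exchange_big (bigD1 n) //= [X in _ + X]big1 ?addr0 => [|m /andP[Nm mn]].
  under eq_bigr => i _ do rewrite -mulrA.
  by rewrite -mulr_sumr dual_coefK // eqxx mulr1.
under eq_bigr => i _ do rewrite -mulrA.
by rewrite -mulr_sumr dual_coefK // (negPf mn) mulr0.
Qed.

Lemma base_act_bij : bijective base_act.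
Proof.
exists base_act_inv => [t | F]; last exact: base_act_invK.
by apply: base_act_inj; rewrite base_act_invK.
Qed.

Definition descent_hopf_galois : hopfGalois K := @HopfGalois k K descent_hopf
  (@descent_val k K N) (@descent_val1 _ _ N) (@descent_valM _ _ N)
  descent_act_mul (fun h => esym (descent_counit_val h)) base_act_bij.

Lemma descent_corresponds : corresponds descent_hopf_galois N.
Proof.
exists coefs; split.
- exact: coefs_inj.
- move=> c; split=> [[h <-] | [suppc eqvc]].
    by split; [apply: coefs_supported | apply: coefs_equivariant].
  by exists (of_coef c); apply: of_coefK.
- split=> [|g h n]; first exact: coefs1.
  transitivity (convolution N (coefs g) (coefs h) n); last by rewrite [LHS]ffunE.
  exact: (congr1 (fun f : {ffun perms -> K} => f n) (coefsM g h)).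
- split=> [h | h m n]; last by rewrite [LHS]ev2_comul; case: eqP => // ->.
  by rewrite descent_counitE.
by move=> h x; rewrite [LHS](permcoefE regN galK).
Qed.

End DescentHopf.

(** * A structure determines its regular subgroup, and conversely *)
Section HopfGaloisUniqueness.

Variables (k : fieldType) (K : splittingFieldType k).
Hypothesis galK : galois 1 {:K}.
Local Notation galG := (gal_of {:K}).
Local Notation perms := {perm galG}.

Lemma sum_tensor_coord (U : vectType k) (V : vectType k) (s : 'I_(\dim {:V}) -> K)
    (f : K -> V -> U) : (forall v, linear (f^~ v)) ->
  tlift f (\matrix_(l, i) coord (vbasis {:K}) l (s i) : tensor K V) =
  \sum_i f (s i) (vbasis {:V})`_i.
Proof.
move=> linf; rewrite [LHS]exchange_big; apply: eq_bigr => i _.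
pose mL := GRing.isLinear.Build k K U _ (f^~ (vbasis {:V})`_i) (linf _).
pose L : {linear K -> U} := HB.pack (f^~ (vbasis {:V})`_i) mL.
rewrite {1}(coord_vbasis (memvf (s i))) -[RHS]/(L _) linear_sum.
by apply: eq_bigr => l _; rewrite mxE linearZ.
Qed.

Lemma amull_comp_linear (F : 'End(K)) : linear (fun s : K => (amull s \o F)%VF).
Proof.
by move=> a s u; rewrite linearP /= comp_lfunDl comp_lfunZl.
Qed.

Lemma gcoef_amull g s (F : 'End(K)) : gcoef g (amull s \o F)%VF = s * gcoef g F.
Proof.
rewrite /gcoef mulr_sumr; apply: eq_bigr => j _.
by rewrite comp_lfunE lfunE /= mulrA.
Qed.

Section HopfGaloisStructure.

Variable A : hopfGalois K.
Local Notation eA := (vbasis {:A}).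

(** The automorphism g0 is in the image of K (x) A, because the map of a Hopf
    Galois structure is surjective. *)
Lemma act_span (g0 : galG) : exists s : 'I_(\dim {:A}) -> K,
  forall g, \sum_i s i * gcoef g (hg_act eA`_i) = (g == g0)%:R.
Proof.
have [inv_act _ actK] := hg_bij A.
pose t := inv_act (g0 : 'End(K)).
exists (fun i => \sum_l t l i *: (vbasis {:K})`_l) => g.
have <- : gcoef g (g0 : 'End(K)) = (g == g0)%:R.
  apply: (gcoef_unique (c := fun h => (h == g0)%:R)) => x.
  rewrite (bigD1 g0) //= eqxx mul1r big1 ?addr0 // => h hg0.
  by rewrite (negPf hg0) mul0r.
rewrite -[X in gcoef g X]actK -/t.
rewrite (linear_tlift (L := gcoef g)); last exact: gcoef_linear.
rewrite [RHS]exchange_big; apply: eq_bigr => i _; rewrite mulr_suml.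
by apply: eq_bigr => l _; rewrite gcoef_amull scalerAl.
Qed.

(** A relation between the coefficients of the action is an element of the
    kernel of the injective map K (x) A -> End_k(K). *)
Lemma act_free (s : 'I_(\dim {:A}) -> K) :
  (forall g, \sum_i s i * gcoef g (hg_act eA`_i) = 0) -> forall i, s i = 0.
Proof.
move=> s0 i; pose t : tensor K A := \matrix_(l, i) coord (vbasis {:K}) l (s i).
have t0 : t = 0.
  apply: (bij_inj (hg_bij A)) => /=.
  rewrite sum_tensor_coord; last by move=> v; apply: amull_comp_linear.
  rewrite [RHS]big1 => [|l _]; last by rewrite big1 // => j _; rewrite mxE scale0r.
  apply/lfunP=> x; rewrite zero_lfunE sum_lfunE.
  under eq_bigr => j _ do rewrite comp_lfunE lfunE /= (gcoefE galK) mulr_sumr.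
  rewrite exchange_big big1 // => g _ /=.
  by under eq_bigr => j _ do rewrite mulrA; rewrite -mulr_suml s0 mul0r.
rewrite (coord_vbasis (memvf (s i))) big1 // => l _.
by have /matrixP/(_ l i) := t0; rewrite !mxE => ->; rewrite scale0r.
Qed.

(** T is a multiplication table for the coefficients of the action of A: the
    product of the terms at a and b contributes to the automorphism T b a. *)
Definition act_table (T : galG -> galG -> galG) := forall (h h' : A) g,
  gcoef g (hg_act (h * h')) = \sum_a \sum_b
    (g == T b a)%:R * (gcoef a (hg_act h) * gcoef b (hg_act h')).

(** By act_span, suitable K-combinations of the defining identities isolate each
    single entry of the table. *)
Lemma act_table_unique T T' : act_table T -> act_table T' -> T =2 T'.
Proof.
move=> tabT tabT' b0 a0; have [s sP] := act_span a0; have [u uP] := act_span b0.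
pose S (T0 : galG -> galG -> galG) (g : galG) : K :=
   \sum_i \sum_j s i * u j * \sum_a \sum_b (g == T0 b a)%:R *
   (gcoef a (hg_act eA`_i) * gcoef b (hg_act eA`_j)).
have SE (T0 : galG -> galG -> galG) g : S T0 g = (g == T0 b0 a0)%:R.
  transitivity (\sum_a \sum_b (g == T0 b a)%:R *
    ((a == a0)%:R * (b == b0)%:R) : K); last first.
    rewrite (bigD1 a0) //= [X in _ + X]big1 ?addr0 => [|a /negPf->]; last first.
      by rewrite big1 // => b _; rewrite mul0r mulr0.
    rewrite (bigD1 b0) //= big1 ?addr0 => [|b /negPf->]; last by rewrite !mulr0.
    by rewrite !eqxx !mulr1.
  rewrite /S; under eq_bigr => i _ do
    (under eq_bigr => j _ do rewrite mulr_sumr; rewrite exchange_big).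
  rewrite exchange_big; apply: eq_bigr => a _.
  under eq_bigr => i _ do
    (under eq_bigr => j _ do rewrite mulr_sumr; rewrite exchange_big).
  rewrite exchange_big; apply: eq_bigr => b _.
  rewrite -sP -uP mulr_suml mulr_sumr; apply: eq_bigr => i _.
  rewrite 2!mulr_sumr; apply: eq_bigr => j _.
  by rewrite mulrCA; congr (_ * _); rewrite mulrACA.
have : S T (T b0 a0) = S T' (T b0 a0).
  by apply: eq_bigr => i _; apply: eq_bigr => j _; rewrite -tabT -tabT'.
rewrite !SE eqxx; case: eqP => // _ /eqP; by rewrite oner_eq0.
Qed.

Variable N : {group perms}.
Hypothesis regN : regular_perm N.

Lemma corresponds_coef (phi : {linear A -> {ffun perms -> K}}) h :
  (forall x, hg_act h x = \sum_(n in N) phi h n * (n^-1%g 1%g : galG) x) ->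
  forall g, gcoef g (hg_act h) = phi h (relabel N g).
Proof.
move=> actE g; apply: (gcoef_unique (c := fun g => phi h (relabel N g))) => x.
rewrite actE (sum_relabel regN); apply: eq_bigr => h' _.
by rewrite -[X in gal_repr X]/(label (relabel N h')) relabelK.
Qed.

(** If m and n in N have labels b and a, the product m * n has label m^-1 a. *)
Lemma corresponds_table : corresponds A N ->
  act_table (fun b a => ((relabel N b)^-1)%g a).
Proof.
case=> phi [_ _ [_ phiM] _ actE] h h' g.
rewrite !(corresponds_coef (actE _)) phiM (sum_relabel regN).
apply: eq_bigr => a _; rewrite big_mkcondr (sum_relabel regN).
apply: eq_bigr => b _; rewrite !(corresponds_coef (actE _)).
suff -> : (relabel N g == relabel N b * relabel N a)%g =
  (g == (relabel N b)^-1%g a) by case: eqP => _; rewrite ?mul1r ?mul0r.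
rewrite -{2}(relabelK regN g) -{2}(relabelK regN a) -labelM.
by rewrite (inj_in_eq (label_inj regN)) ?groupM ?mem_relabel.
Qed.

End HopfGaloisStructure.

Lemma corresponds_lin_disjoint (A : hopfGalois K) (N : {group perms})
    (phi : {linear A -> {ffun perms -> K}}) : regular_perm N ->
    (forall h x, hg_act h x = \sum_(n in N) phi h n * (n^-1%g 1%g : galG) x) ->
  lin_disjoint phi.
Proof.
move=> regN actE s s0; apply: act_free => g.
by under eq_bigr => i _ do rewrite (corresponds_coef regN (actE _)).
Qed.

(** Over a field the injection phiB has a linear left inverse on its image. *)
Lemma corresponds_transfer (A B : hopfGalois K)
    (phiA : {linear A -> {ffun perms -> K}})
    (phiB : {linear B -> {ffun perms -> K}}) :
  (forall h, exists h', phiB h' = phiA h) ->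
  exists f : {linear A -> B}, forall h, phiB (f h) = phiA h.
Proof.
move=> imAB; pose g : 'Hom(A, B) := ((linfun phiB)^-1 \o linfun phiA)%VF.
exists g => h; rewrite -[LHS]/(phiB (g h)) comp_lfunE [linfun phiA h]lfunE -[LHS]lfunE limg_lfunVK //=.
by have [h' <-] := imAB h; rewrite -[phiB h']lfunE memv_img ?memvf.
Qed.

(** Both algebras have the same image in K[N], and their operations are read off
    from the coefficients; for the comultiplication this uses that coefficients
    separate tensors. *)
Lemma corresponds_iso (A B : hopfGalois K) (N : {group perms}) :
  regular_perm N -> corresponds A N -> corresponds B N -> hg_iso A B.
Proof.
move=> regN [phiA [injA imA [A1 AM] [A_eps A_com] A_act]].
move=> [phiB [injB imB [B1 BM] [B_eps B_com] B_act]].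
have [|f fE] := @corresponds_transfer A B phiA phiB.
  by move=> h; apply/imB/imA; exists h.
have [|f' f'E] := @corresponds_transfer B A phiB phiA.
  by move=> h; apply/imA/imB; exists h.
exists f; split.
- by exists f' => h; [apply: injA | apply: injB]; rewrite ?f'E ?fE ?f'E.
- split=> [|g h]; first by apply: injB; rewrite fE A1 B1.
  by apply: injB; apply/ffunP=> n; rewrite fE AM BM !fE.
- move=> h; apply: (ev2_inj (corresponds_lin_disjoint regN B_act)) => m n.
  rewrite [LHS]B_com fE -A_com ev2_tlift; apply: eq_tlift => x y.
  by rewrite ev2_tens !fE.
- move=> h; apply: (fmorph_inj (in_alg K)); rewrite /= -A_eps -B_eps.
  by rewrite fE.
by move=> h; apply/lfunP=> x; rewrite B_act A_act fE.
Qed.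

(** An isomorphism preserves the action, so A has the tables of both N and M. The
    table of N at b is the permutation inverse to the element of N with label b,
    hence N and M have the same elements. *)
Lemma iso_corresponds (A B : hopfGalois K) (N M : {group perms}) :
    regular_perm N -> regular_perm M -> corresponds A N -> corresponds B M ->
  hg_iso A B -> N = M.
Proof.
move=> regN regM corrA corrB [f [_ [_ fM] _ _ f_act]].
have tabN := corresponds_table regN corrA.
have tabM : act_table A (fun b a => ((relabel M b)^-1)%g a).
  move=> h h' g; rewrite -!f_act fM.
  exact: (corresponds_table regM corrB).
have eqNM b : relabel N b = relabel M b.
  apply: invg_inj; apply/permP=> a.
  exact: (act_table_unique tabN tabM).
apply/group_inj/setP=> n; apply/idP/idP => [Nn | Mn].
  by rewrite -(labelK regN Nn) eqNM mem_relabel.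
by rewrite -(labelK regM Mn) -eqNM mem_relabel.
Qed.

End HopfGaloisUniqueness.

(** * From Hopf Galois structures to regular subgroups *)
Section CountingStructures.

Definition regularb (gT : finGroupType) (N : {set {perm gT}}) :=
  [forall x, forall y, #|[set n in N | n x == y]| == 1%N].

(** For a Galois group this is the translation lambda g. *)
Definition rmul (gT : finGroupType) (g : gT) : {perm gT} := perm (mulIg g).

Definition right_normalized (gT : finGroupType) (N : {set {perm gT}}) :=
  [forall g : gT, rmul g \in 'N(N)%g].

Definition regular_subgroups (gT aT : finGroupType) (T : {group aT}) :=
  [set N : {group {perm gT}} |
    [&& regularb N, right_normalized N & N \isog T]].

Lemma regular_permP (k : fieldType) (K : splittingFieldType k)
    (N : {group {perm gal_of {:K}}}) : reflect (regular_perm N) (regularb N).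
Proof.
apply: (iffP 'forall_forallP) => regN x y.
  have /cards1P[n defn] := regN x y; exists n; split=> [|n' [Nn' n'x]].
    by have: n \in [set n] := set11 n; rewrite -defn inE => /andP[? /eqP].
  have: n' \in [set n] by rewrite -defn inE Nn' n'x eqxx.
  by rewrite inE => /eqP.
have [n [[Nn nx] uniq_n]] := regN x y; apply/cards1P; exists n.
apply/setP=> n'; rewrite !inE; apply/andP/eqP => [[Nn' /eqP n'x] | ->].
  exact/esym/uniq_n.
by rewrite Nn nx.
Qed.

Lemma num_hopfGalois_card (k : fieldType) (K : splittingFieldType k)
    (aT : finGroupType) (T : {group aT}) (m : nat) :
    galois 1 {:K} -> #|regular_subgroups (gal_of {:K}) T| = m ->
  num_hopfGalois K T m.
Proof.
move=> galK <-; set X := regular_subgroups _ _.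
have XP (i : 'I_#|X|) : [/\ regular_perm (enum_val i),
    lambda_normalized (enum_val i) & enum_val i \isog T].
  have := enum_valP i; rewrite inE => /and3P[/regular_permP regN /forallP normN].
  by split.
have [s sP] : exists s : 'I_#|X| -> hopfGalois K,
    forall i, corresponds (s i) (enum_val i).
  apply: (@fin_all_exists _ (fun=> hopfGalois K)
    (fun i A => corresponds A (enum_val i))) => i; have [regN normN _] := XP i.
  exists (descent_hopf_galois (GpSubgroup regN normN galK)).
  exact: (descent_corresponds (GpSubgroup regN normN galK)).
exists s; split=> [i | i j | A [N [regN normN corrA isoN]]].
- by have [regN normN isoN] := XP i; exists (enum_val i).
- move=> iso_ij; apply: enum_val_inj.
  have [regi _ _] := XP i; have [regj _ _] := XP j.
  exact: (iso_corresponds regi regj (sP i) (sP j) iso_ij).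
have XN : N \in X.
  rewrite inE isoN andbT; apply/andP; split; first exact/regular_permP.
  exact/forallP.
exists (enum_rank_in XN N); apply: (corresponds_iso galK regN corrA).
by have := sP (enum_rank_in XN N); rewrite enum_rankK_in.
Qed.

End CountingStructures.

Local Close Scope ring_scope.
Local Open Scope group_scope.

(** * Groups of type C_6p x C_2 *)
Lemma expg_pair (aT bT : finGroupType) (a : aT) (b : bT) m :
  (a, b) ^+ m = (a ^+ m, b ^+ m).
Proof. by elim: m => // m IHm; rewrite !expgS IHm. Qed.

Section AbelianType.

(** An element whose order is the exponent spans a direct factor; the complement
    has prime order. *)
Lemma isog_abelian_prime_index (aT rT : finGroupType) (A : {group aT})
    (B : {group rT}) q : prime q -> abelian A -> abelian B ->
    exponent A = exponent B -> #|A| = (exponent A * q)%N -> #|A| = #|B| ->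
  A \isog B.
Proof.
move=> q_pr cAA cBB eqe oA oB.
have split_cyclic (gT : finGroupType) (C : {group gT}) : abelian C ->
    #|C| = (exponent C * q)%N ->
    exists x, exists2 H : {group gT}, <[x]> \x H = C & #[x] = exponent C /\ #|H| = q.
  move=> cCC oC; have [x Cx ox] := exponent_witness (abelian_nil cCC).
  have /splitsP[H /complP[tixH defC]] := abelian_splits Cx (esym ox) cCC.
  exists x, H.
    by rewrite dprodE // (sub_abelian_cent2 cCC) ?cycle_subG // -defC mulG_subr.
  split=> //; apply/eqP; rewrite -(eqn_pmul2l (exponent_gt0 C)) -oC -{2}defC.
  by rewrite TI_cardMg // -orderE ox.
have [x [H defA [ox oH]]] := split_cyclic _ A cAA oA.
have oB' : #|B| = (exponent B * q)%N by rewrite -oB oA eqe.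
have [y [L defB [oy oL]]] := split_cyclic _ B cBB oB'.
apply: (isog_dprod defA defB).
  by rewrite isog_cyclic_card ?cycle_cyclic -?orderE ?oy ?ox ?eqe /=.
by rewrite isog_cyclic_card ?prime_cyclic ?oH ?oL ?eqxx.
Qed.

Variable p : nat.
Hypotheses (p_pr : prime p) (p_gt3 : 3 < p).

Lemma coprime_p12 : coprime p 12.
Proof.
rewrite prime_coprime // (_ : 12 = 2 * 2 * 3)%N // !Euclid_dvdM // !dvdn_prime2 //.
by rewrite !orbb negb_or !neq_ltn (ltn_trans _ p_gt3) // p_gt3 !orbT.
Qed.

Lemma exponent_6p (gT : finGroupType) (A : {group gT}) :
  #|A| = (12 * p)%N -> exponent A %| 6 * p -> exponent A = (6 * p)%N.
Proof.
move=> oA eA; apply/eqP; rewrite eqn_dvd eA.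
have dvd_e q : prime q -> q %| 12 * p -> q %| exponent A.
  move=> q_pr q_dvd; have : q \in \pi(A) by rewrite mem_primes q_pr /= oA q_dvd muln_gt0 (prime_gt0 p_pr).
  by rewrite -pi_of_exponent mem_primes => /and3P[].
have co_p6 : coprime 6 p.
  by have := coprime_p12; rewrite coprime_sym (_ : 12 = 6 * 2)%N // coprimeMl => /andP[].
rewrite Gauss_dvd // (@Gauss_dvd 2 3) // !dvd_e //.
- exact: dvdn_mull.
- by rewrite dvdn_mulr.
by rewrite dvdn_mulr.
Qed.

Lemma card_Zp_pair : #|[set: 'Z_(6 * p) * 'Z_2]| = (12 * p)%N.
Proof.
have p6 : 1 < 6 * p by rewrite (leq_trans _ (leq_pmulr 6 (prime_gt0 p_pr))).
by rewrite cardsT card_prod !card_ord Zp_cast // mulnC mulnA.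
Qed.

(** The primes dividing the exponent are those dividing the order, 2, 3 and p,
    so an exponent dividing 6p equals 6p. *)
Lemma isog_Zp_pair (gT : finGroupType) (A : {group gT}) :
  (A \isog [set: 'Z_(6 * p) * 'Z_2]) =
  [&& abelian A, #|A| == (12 * p)%N & exponent A %| 6 * p].
Proof.
have p6 : 1 < 6 * p by rewrite (leq_trans _ (leq_pmulr 6 (prime_gt0 p_pr))).
pose T := [set: 'Z_(6 * p) * 'Z_2]%G.
have cTT : abelian T.
  apply/centsP=> -[a b] _ [c d] _; congr pair; exact: addrC.
have oT : #|T| = (12 * p)%N := card_Zp_pair.
have eT : exponent T %| 6 * p.
  apply/exponentP=> -[a b] _.
  have e1 : a ^+ (6 * p) = 1.
    apply/eqP; rewrite -order_dvdn; apply: dvdn_trans (order_dvdG (in_setT a)) _.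
    by rewrite cardsT card_ord Zp_cast.
  have e2 : b ^+ (6 * p) = 1.
    apply/eqP; rewrite -order_dvdn; apply: dvdn_trans (order_dvdG (in_setT b)) _.
    by rewrite cardsT card_ord -[6]/(2 * 3)%N -mulnA dvdn_mulr.
  by rewrite expg_pair e1 e2.
apply/idP/and3P => [isoAT | [cAA /eqP oA eA]].
  rewrite (isog_abelian isoAT) (card_isog isoAT) (exponent_isog isoAT).
  by rewrite card_Zp_pair.
apply: (@isog_abelian_prime_index _ _ A T 2) => //.
- by rewrite (exponent_6p oA eA) (exponent_6p oT eT).
- by rewrite (exponent_6p oA eA) oA mulnAC.
by rewrite oA oT.
Qed.

End AbelianType.

(** * Block systems of a normalized regular group *)
Section RegularAction.

Variable gT : finGroupType.
Implicit Types (N M : {group {perm gT}}) (g x y : gT) (n m : {perm gT}).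

Lemma rmulE g x : rmul g x = x * g.
Proof. by rewrite permE. Qed.

Lemma rmulVE g x : (rmul g)^-1 x = x * g^-1.
Proof. by apply: (canLR (permK _)); rewrite rmulE mulgKV. Qed.

Lemma conj_rmulE n g x : (n ^ rmul g) x = n (x * g^-1) * g.
Proof. by rewrite conjgE !permM rmulVE rmulE. Qed.

Lemma rmulM g h : rmul (g * h) = rmul g * rmul h.
Proof. by apply/permP=> x; rewrite permM !rmulE mulgA. Qed.

Section Regular.

Variable N : {group {perm gT}}.
Hypothesis regN : regularb N.

Lemma regular_free x : {in N &, injective (fun n => n x)}.
Proof.
move=> n m Nn Nm eq_nm; have /'forall_forallP/(_ x (m x)) := regN.
case/cards1P=> q defq; apply: (@etrans _ _ q); last symmetry.
  by apply/eqP; rewrite -in_set1 -defq inE Nn eq_nm eqxx.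
by apply/eqP; rewrite -in_set1 -defq inE Nm eqxx.
Qed.

Lemma regular_trans x y : exists2 n, n \in N & n x = y.
Proof.
have /'forall_forallP/(_ x y)/cards1P[n /setP/(_ n)] := regN.
by rewrite !inE eqxx => /andP[Nn /eqP]; exists n.
Qed.

Lemma regular_card : #|N| = #|gT|.
Proof.
rewrite -cardsT -(card_in_imset (@regular_free 1)); congr #|pred_of_set _|.
by apply/setP=> y; rewrite !inE; have [n Nn <-] := regular_trans 1 y; rewrite imset_f.
Qed.

End Regular.

Lemma right_normalizedJ N g n : right_normalized N -> (n ^ rmul g \in N) = (n \in N).
Proof. by move/forallP/(_ g)=> normNg; rewrite memJ_norm. Qed.

Lemma right_normalized_char N M : M \char N -> right_normalized N -> right_normalized M.
Proof.
move=> charM /forallP normN; apply/forallP=> g.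
exact: (subsetP (char_norms charM)).
Qed.

(** The orbit of 1; when M is normalized by right translations, it is a subgroup
    of G and the orbits of M are its right cosets. *)
Definition orbit1 (M : {set {perm gT}}) : {set gT} := [set n 1 | n : {perm gT} in M].

Section Orbit.

Variable M : {group {perm gT}}.
Hypothesis normM : right_normalized M.

Lemma mem_orbit1P x y :
  reflect (exists2 m, m \in M & x = m y) (x * y^-1 \in orbit1 M).
Proof.
apply: (iffP imsetP) => [[m Mm eq_m] | [m Mm ->]].
  exists (m ^ rmul y); first by rewrite right_normalizedJ.
  by rewrite conj_rmulE mulgV -eq_m mulgKV.
exists (m ^ rmul y^-1); first by rewrite right_normalizedJ.
by rewrite conj_rmulE invgK mul1g.
Qed.

Lemma orbit1_group_set : group_set (orbit1 M).
Proof.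
apply/group_setP; split=> [|x y]; first by apply/imsetP; exists 1; rewrite ?perm1.
move=> Mx /imsetP[m' Mm' eq_y].
have /mem_orbit1P[m Mm eq_xy] : (x * y) * y^-1 \in orbit1 M by rewrite mulgK.
by apply/imsetP; exists (m' * m); rewrite ?groupM // permM -eq_y.
Qed.

End Orbit.

(** For abelian N as below the set orbit1 is itself a group; the generated
    group only serves to make hall_orbit a group in all cases. *)
Definition hall_orbit pi (N : {group {perm gT}}) := <<orbit1 'O_pi(N)>>%G.

Section HallOrbit.

Variables (pi : nat_pred) (N : {group {perm gT}}).
Hypotheses (regN : regularb N) (normN : right_normalized N) (cNN : abelian N).

Lemma normed_pcore : right_normalized 'O_pi(N).
Proof. exact: right_normalized_char (pcore_char _ _) normN. Qed.

Lemma hall_orbitE : hall_orbit pi N :=: orbit1 'O_pi(N).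
Proof.
rewrite /= -[X in <<X>>]/(gval (Group (orbit1_group_set normed_pcore))).
exact: genGid.
Qed.

Lemma card_hall_orbit : #|hall_orbit pi N| = (#|gT|`_pi)%N.
Proof.
rewrite hall_orbitE card_in_imset.
  rewrite (card_Hall (nilpotent_pcore_Hall pi (abelian_nil cNN))).
  by rewrite regular_card.
by move=> n m Mn Mm; apply: (regular_free regN); apply: (subsetP (pcore_sub pi N)).
Qed.

Lemma hall_orbitP x y :
  reflect (exists2 m, m \in 'O_pi(N) & x = m y) (x * y^-1 \in hall_orbit pi N).
Proof. by rewrite hall_orbitE; apply: mem_orbit1P normed_pcore _ _. Qed.

End HallOrbit.

End RegularAction.

(** * Translations of a coset space *)
Section CosetLabels.

Variables (gT eT : finGroupType).

(** The map a identifies the coset space H \ G with a subset of eT. *)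
Definition coset_label (H : {set gT}) (a : gT -> eT) :=
  forall x y, (a x == a y) = (x * y^-1 \in H).

(** The permutation n induces the translation by (a x)^-1 a (n x), which does not
    depend on x. *)
Definition translation (a : gT -> eT) (n : {perm gT}) :=
  forall x y, a (n y) = a y * ((a x)^-1 * a (n x)).

Lemma full_seq (s : seq eT) (e : eT) : uniq s -> size s = #|eT| -> e \in s.
Proof.
move=> uniq_s size_s.
have sub : {subset s <= enum eT} by move=> f _; rewrite mem_enum.
have le_size : size (enum eT) <= size s by rewrite size_s cardE.
by have [_ ->] := uniq_min_size uniq_s sub le_size; rewrite mem_enum.
Qed.

(** Permutations of the label set are described by maps f on a set above it, so
    that the next two lemmas apply to permutations of G. *)
Section FixedPointFree.

Variables (T : Type) (b : T -> eT) (f : T -> T).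
Hypothesis ind : forall x y, b x = b y -> b (f x) = b (f y).
Hypothesis nfix : forall x, b (f x) != b x.

(** On four points a fixed-point-free involution lies in the Klein group: unless
    y lies over x or f x, the labels of x, f x, y, f y are all the elements of eT,
    and b y (b x)^-1 b (f x) is none of the first three. *)
Lemma involution_translation : #|eT| = 4 -> (forall e : eT, e ^+ 2 = 1) ->
  (forall x, b (f (f x)) = b x) ->
  forall x y, b (f y) = b y * ((b x)^-1 * b (f x)).
Proof.
move=> oE expE nn.
have invE (e : eT) : e^-1 = e by apply/eqP; rewrite eq_invg_mul; apply/eqP/expE.
have cE (e e' : eT) : e * e' = e' * e by rewrite -[e * e']invE invMg !invE.
move=> x y; have [eq_xy | ne_xy] := eqVneq (b x) (b y).
  by rewrite (ind (esym eq_xy)) eq_xy mulKVg.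
have [eq_nxy | ne_nxy] := eqVneq (b (f x)) (b y).
  by rewrite -(ind eq_nxy) nn -eq_nxy invE cE -[X in _ * X]invE mulgK.
have ne_ff : b (f x) != b (f y).
  by apply: contraNneq ne_xy => /(ind); rewrite !nn => ->.
have ne_f : b x != b (f y).
  by apply: contraNneq ne_nxy => /(ind); rewrite nn => ->.
have uniq_s : uniq [:: b x; b (f x); b y; b (f y)].
  rewrite /= !inE !negb_or ne_xy ne_nxy ne_ff ne_f.
  by rewrite [b x == _]eq_sym [b y == _]eq_sym !nfix.
have := full_seq (b y * ((b x)^-1 * b (f x))) uniq_s (esym oE).
rewrite !inE => /or4P[] /eqP eqz; last by rewrite eqz.
- case/eqP: ne_nxy; rewrite -[b y](mulgK ((b x)^-1 * b (f x))) eqz invMg invgK.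
  by rewrite [b (f x)]lock invE -lock [_ * b x]cE -{1}[b x]invE mulKg.
- by case/eqP: ne_xy; apply: (mulIg ((b x)^-1 * b (f x))); rewrite eqz mulKVg.
case/eqP: (nfix x); apply: (mulgI (b x)^-1); rewrite mulVg.
by apply: (mulgI (b y)); rewrite eqz mulg1.
Qed.

(** On three points b x, b (f x), b (f (f x)) are all the elements of eT, and the
    third one can only be b x c^2 with c = (b x)^-1 b (f x). *)
Lemma three_cycle_translation : #|eT| = 3 -> (forall x, b (f (f x)) != b x) ->
  (forall x, b (f (f (f x))) = b x) ->
  forall x y, b (f y) = b y * ((b x)^-1 * b (f x)).
Proof.
move=> oE nn nnn.
have expE (e : eT) : e ^+ 3 = 1.
  by apply/eqP; rewrite -order_dvdn -oE -cardsT order_dvdG ?inE.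
move=> x y; set c := (b x)^-1 * b (f x).
have ac : b (f x) = b x * c by rewrite mulKVg.
have c1 : c != 1 by rewrite -(inj_eq (mulgI (b x))) mulg1 -ac.
have c2 : c ^+ 2 != 1.
  by apply: contraNneq c1 => c2; rewrite -(expE c) expgS c2 mulg1.
have uniq_s : uniq [:: b x; b (f x); b (f (f x))].
  have n1 : b x != b (f x) by rewrite eq_sym nfix.
  have n2 : b x != b (f (f x)) by rewrite eq_sym nn.
  have n3 : b (f x) != b (f (f x)) by rewrite eq_sym nfix.
  by rewrite /= !inE !negb_or n1 n2 n3.
have acc : b (f (f x)) = b x * c ^+ 2.
  have := full_seq (b x * c ^+ 2) uniq_s (esym oE).
  rewrite !inE => /or3P[] /eqP // eqc.
    by case/eqP: c2; apply: (mulgI (b x)); rewrite eqc mulg1.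
  case/eqP: c1; apply: (mulgI c); rewrite mulg1; apply: (mulgI (b x)).
  by rewrite -ac -eqc.
have := full_seq (b y) uniq_s (esym oE).
rewrite !inE => /or3P[] /eqP eqy; rewrite (ind eqy) eqy.
- exact: ac.
- by rewrite acc ac -mulgA.
by rewrite nnn acc -mulgA -expgSr expE mulg1.
Qed.

End FixedPointFree.

Section LabelledHallOrbit.

Implicit Types (x y : gT) (n m : {perm gT}).

Variables (pi : nat_pred) (N : {group {perm gT}}) (a : gT -> eT).
Hypotheses (regN : regularb N) (normN : right_normalized N) (cNN : abelian N).
Hypothesis labela : coset_label (hall_orbit pi N) a.
Local Notation M := ('O_pi(N)).

Lemma label_pcore m y : m \in M -> a (m y) = a y.
Proof. by move=> Mm; apply/eqP; rewrite labela; apply/hall_orbitP => //; exists m. Qed.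

(** If n x and x have the same label, then n x = m x with m in the pi-part, and n = m
    by regularity: the elements of N outside its pi-part fix no label. *)
Lemma label_fix n x : n \in N -> a (n x) = a x -> n \in M.
Proof.
move=> Nn /eqP; rewrite labela => /hall_orbitP[] // m Mm eq_nm.
by rewrite (regular_free regN Nn _ eq_nm) // (subsetP (pcore_sub pi N)).
Qed.

Lemma label_induced n x y : n \in N -> a x = a y -> a (n x) = a (n y).
Proof.
move=> Nn /eqP; rewrite labela => /hall_orbitP[] // m Mm ->.
have -> : n (m y) = m (n y).
  by rewrite -!permM (centsP cNN m (subsetP (pcore_sub pi N) m Mm) n Nn).
exact: label_pcore.
Qed.

Lemma label_pcore_translation n : n \in M -> translation a n.
Proof. by move=> Mn x y; rewrite !label_pcore // mulVg mulg1. Qed.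

Lemma label_translation4 n : #|eT| = 4 -> (forall e : eT, e ^+ 2 = 1) ->
  n \in N -> n ^+ 2 \in M -> translation a n.
Proof.
move=> oE expE Nn Mn2; have [/label_pcore_translation// | notMn] := boolP (n \in M).
apply: involution_translation => // [x y|x|x]; first exact: label_induced.
  by apply: contraNneq notMn; apply: label_fix.
by rewrite -permM; apply: (label_pcore x Mn2).
Qed.

Lemma label_translation3 n : #|eT| = 3 -> n \in N -> n ^+ 3 \in M -> translation a n.
Proof.
move=> oE Nn Mn3; have [/label_pcore_translation// | notMn] := boolP (n \in M).
apply: three_cycle_translation => // [x y|x|x|x]; first exact: label_induced.
- by apply: contraNneq notMn; apply: label_fix.
- apply: contraNneq notMn; rewrite -permM => /(label_fix (groupX 2 Nn)) Mn2.
  by rewrite -(groupMl _ Mn2) -expgSr.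
by rewrite -!permM; apply: (label_pcore x Mn3).
Qed.

(** The translations by P permute the labels simply transitively and n commutes
    with them modulo the pi-part of N, so n is itself a translation. *)
Lemma label_translation_normal (P : {set gT}) (phi : gT -> eT) n :
    (forall e f : eT, e * f = f * e) ->
    (forall x u, u \in P -> a (x * u) = a x * phi u) ->
    (forall e, exists2 u, u \in P & phi u = e) ->
    (forall u, u \in P -> n ^ rmul u^-1 \in M :* n) -> n \in N ->
  translation a n.
Proof.
move=> cE aP phi_surj normP Nn x y.
have [u Pu phiu] := phi_surj ((a x)^-1 * a y).
have eq_y : a y = a (x * u) by rewrite aP // phiu mulKVg.
rewrite (label_induced Nn eq_y).
have -> : n (x * u) = (n ^ rmul u^-1) x * u by rewrite conj_rmulE invgK mulgKV.
rewrite aP //; have /rcosetP[m Mm ->] := normP u Pu.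
rewrite permM (label_induced Nn (label_pcore x Mm)) phiu.
by rewrite cE -mulgA [a y * _]cE -!mulgA; congr (_ * _); rewrite cE.
Qed.

End LabelledHallOrbit.

Section Stability.

Variables (H : {group gT}) (a : gT -> eT).
Hypothesis labela : coset_label H a.
Implicit Types (x y g : gT) (n m : {perm gT}).

(** The right translations of G normalize the permutations inducing
    translations. *)
Definition stable_label := forall n g, translation a n -> translation a (n ^ rmul g).

Lemma label_mulr x y g : a x = a y -> a (x * g) = a (y * g).
Proof.
by move/eqP; rewrite labela => Hxy; apply/eqP; rewrite labela invMg mulgA mulgK.
Qed.

Lemma label_mulr_inj x y g : a (x * g) = a (y * g) -> a x = a y.
Proof. by move/(label_mulr g^-1); rewrite !mulgK. Qed.

Lemma translation_induced n x y : translation a n -> a x = a y -> a (n x) = a (n y).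
Proof. by move=> trn eqa; rewrite (trn x y) eqa mulKVg. Qed.

Lemma conj_induced n g : translation a n ->
  forall x y, a x = a y -> a ((n ^ rmul g) x) = a ((n ^ rmul g) y).
Proof.
move=> trn x y eqa; rewrite !conj_rmulE; apply/label_mulr/(translation_induced trn).
exact: label_mulr.
Qed.

Lemma translation_iter n k x : translation a n ->
  a ((n ^+ k) x) = a x * ((a 1)^-1 * a (n 1)) ^+ k.
Proof.
move=> trn; elim: k => [|k IHk]; first by rewrite perm1 mulg1.
by rewrite expgSr permM (trn 1 ((n ^+ k) x)) IHk -[LHS]mulgA expgSr.
Qed.

Lemma conj_rmulX n g k x : ((n ^ rmul g) ^+ k) x = (n ^+ k) (x * g^-1) * g.
Proof. by rewrite -conjXg conj_rmulE. Qed.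

(** Conjugation preserves fixed-point-free involutions. *)
Lemma stable_label4 : #|eT| = 4 -> (forall e : eT, e ^+ 2 = 1) -> stable_label.
Proof.
move=> oE expE n g trn; set c := (a 1)^-1 * a (n 1).
have nE x : a (n x) = a x * c by rewrite (trn 1).
have [c1 | nc1] := eqVneq c 1.
  suff nx x : a ((n ^ rmul g) x) = a x by move=> x y; rewrite !nx mulVg mulg1.
  by rewrite conj_rmulE -[in RHS](mulgKV g x); apply: label_mulr; rewrite nE c1 mulg1.
apply: involution_translation => // [|x|x]; first exact: conj_induced.
  apply: contraNneq nc1; rewrite conj_rmulE -[in X in _ = X -> _](mulgKV g x).
  move/label_mulr_inj=> eqc; apply/eqP/(mulgI (a (x * g^-1))).
  by rewrite mulg1 -nE.
have := conj_rmulX n g 2 x; rewrite [in LHS]permM => ->.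
rewrite -[in RHS](mulgKV g x); apply: label_mulr.
by rewrite translation_iter // expE mulg1.
Qed.

(** Conjugation preserves fixed-point-free permutations of order 3. *)
Lemma stable_label3 : #|eT| = 3 -> stable_label.
Proof.
move=> oE n g trn; set c := (a 1)^-1 * a (n 1).
have nE x : a (n x) = a x * c by rewrite (trn 1).
have expE (e : eT) : e ^+ 3 = 1.
  by apply/eqP; rewrite -order_dvdn -oE -cardsT order_dvdG ?inE.
have [c1 | nc1] := eqVneq c 1.
  suff nx x : a ((n ^ rmul g) x) = a x by move=> x y; rewrite !nx mulVg mulg1.
  by rewrite conj_rmulE -[in RHS](mulgKV g x); apply: label_mulr; rewrite nE c1 mulg1.
have nfixk k x : a (((n ^ rmul g) ^+ k) x) = a x -> c ^+ k = 1.
  rewrite conj_rmulX -[in X in _ = X -> _](mulgKV g x) => /label_mulr_inj.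
  by rewrite translation_iter // => eqc; apply: (mulgI (a (x * g^-1))); rewrite mulg1.
have fixk k x : c ^+ k = 1 -> a (((n ^ rmul g) ^+ k) x) = a x.
  move=> ck; rewrite conj_rmulX -[in RHS](mulgKV g x); apply: label_mulr.
  by rewrite translation_iter // ck mulg1.
apply: three_cycle_translation => // [|x|x|x]; first exact: conj_induced.
- by apply: contraNneq nc1 => e1; have := nfixk 1%N x e1; rewrite expg1 => ->.
- apply: contraNneq nc1; rewrite -permM => /(nfixk 2) c2.
  by rewrite -(expE c) expgS c2 mulg1.
by rewrite -!permM; apply: (fixk 3).
Qed.

Lemma exists_label : #|gT| = (#|eT| * #|H|)%N -> exists b, coset_label H b.
Proof.
move=> oG; pose R := rcosets H [set: gT].
have oR : #|R| = #|eT|.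
  apply/eqP; rewrite -(eqn_pmul2r (cardG_gt0 H)) -oG -cardsT mulnC.
  by rewrite Lagrange ?subsetT.
exists (fun x => nth 1 (enum eT) (index (H :* x) (enum R))) => x y.
have memR z : H :* z \in enum R by rewrite mem_enum; apply/rcosetsP; exists z.
have idx z : index (H :* z) (enum R) < size (enum eT).
  by rewrite -cardE -oR cardE index_mem.
rewrite nth_uniq ?enum_uniq //.
have -> : (index (H :* x) (enum R) == index (H :* y) (enum R)) = (H :* x == H :* y).
  apply/eqP/eqP => [eqi | -> //].
  by rewrite -(nth_index (H :* x) (memR x)) eqi nth_index.
by rewrite -mem_rcoset; apply/eqP/idP => /rcoset_eqP.
Qed.

End Stability.

End CosetLabels.

Section NormalComplementLabel.

Variables (gT : finGroupType) (P H : {group gT}).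
Hypotheses (cPP : abelian P) (nPG : P <| [set: gT]).
Hypotheses (HP : H * P = [set: gT]) (tiHP : H :&: P = 1).
Implicit Types (x y g u : gT).

(** Each coset of a complement H of P has one representative in P, which is its
    label. *)
Definition complement_label x : subg_of P := subg P (remgr H P x).

Lemma sgval_complement_label x : sgval (complement_label x) = remgr H P x.
Proof. by rewrite subgK // mem_remgr // HP inE. Qed.

Lemma complement_split x :
  exists2 h, h \in H & x = h * sgval (complement_label x).
Proof.
exists (divgr H P x); first by rewrite mem_divgr // HP inE.
by rewrite sgval_complement_label -divgr_eq.
Qed.

Lemma complement_labelE h u : h \in H -> u \in P -> complement_label (h * u) = subg P u.
Proof. by move=> Hh Pu; rewrite /complement_label remgrMid. Qed.

Lemma complement_coset_label : coset_label H complement_label.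
Proof.
move=> x y; have [h Hh eqx] := complement_split x.
have [h' Hh' eqy] := complement_split y.
apply/eqP/idP => [eqa | Hxy].
  by rewrite eqx eqy eqa invMg mulgA mulgK groupM ?groupV.
rewrite -[x](mulgKV y) {2}eqy mulgA.
by rewrite (complement_labelE (groupM Hxy Hh')) ?sgvalK ?subgP.
Qed.

Lemma complement_labelM x u :
  u \in P -> complement_label (x * u) = complement_label x * subg P u.
Proof.
move=> Pu; have [h Hh eqx] := complement_split x.
apply: subg_inj; rewrite {1}eqx -mulgA complement_labelE ?groupM ?subgP //.
by rewrite subgM ?subgP // sgvalK.
Qed.

(** G acts on these labels by affine maps: conjugations of P composed with
    translations. *)
Lemma complement_stable : stable_label complement_label.
Proof.
have cE (e f : subg_of P) : e * f = f * e.
  by apply: subg_inj; rewrite /= (centsP cPP) ?subgP.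
have conjP g u : u \in P -> u ^ g \in P.
  by move=> Pu; rewrite memJ_norm // (subsetP (normal_norm nPG)) ?inE.
have labelJ x u g : u \in P ->
    complement_label (x * u * g) = complement_label (x * g) * subg P (u ^ g).
  by move=> Pu; rewrite -complement_labelM ?conjP // -mulgA [u * g]conjgC mulgA.
move=> n g trn; set c := (complement_label 1)^-1 * complement_label (n 1).
have nE x : complement_label (n x) = complement_label (x * sgval c).
  by rewrite complement_labelM ?subgP // sgvalK (trn 1).
suff nJ x : complement_label ((n ^ rmul g) x) =
    complement_label x * subg P (sgval c ^ g).
  by move=> x y; rewrite !nJ mulKg.
rewrite conj_rmulE (label_mulr complement_coset_label g (nE _)).
by rewrite labelJ ?subgP // mulgKV.
Qed.

End NormalComplementLabel.

(** * The regular group of a triple of subgroups *)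
Section TranslationGroup.

Variables (gT eT1 eT2 eT3 : finGroupType) (H1 H2 H3 : {group gT}).
Variables (a1 : gT -> eT1) (a2 : gT -> eT2) (a3 : gT -> eT3).
Hypotheses (label1 : coset_label H1 a1) (label2 : coset_label H2 a2)
           (label3 : coset_label H3 a3).
Hypothesis tiH : H1 :&: H2 :&: H3 = 1.
Implicit Types (x y g : gT) (n m : {perm gT}).

Lemma labels_inj x y : a1 x = a1 y -> a2 x = a2 y -> a3 x = a3 y -> x = y.
Proof.
move/eqP; rewrite label1 => Hxy1 /eqP; rewrite label2 => Hxy2 /eqP.
rewrite label3 => Hxy3; apply/eqP; rewrite eq_mulgV1 -in_set1.
by rewrite -[[set 1]]/(1 : {set gT}) -tiH !inE Hxy1 Hxy2.
Qed.

Definition translations n := [/\ translation a1 n, translation a2 n & translation a3 n].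

Lemma translations_eq n m : translations n -> translations m -> n 1 = m 1 -> n = m.
Proof.
move=> [n1 n2 n3] [m1 m2 m3] eq1; apply/permP=> x; apply: labels_inj.
- by rewrite (n1 1) (m1 1) eq1.
- by rewrite (n2 1) (m2 1) eq1.
by rewrite (n3 1) (m3 1) eq1.
Qed.

Hypotheses (cE1 : forall e f : eT1, e * f = f * e)
  (cE2 : forall e f : eT2, e * f = f * e) (cE3 : forall e f : eT3, e * f = f * e).
Hypothesis oG : #|gT| = (#|eT1| * #|eT2| * #|eT3|)%N.
Hypotheses (stable1 : stable_label a1) (stable2 : stable_label a2)
           (stable3 : stable_label a3).

Definition translationb (eT : finGroupType) (a : gT -> eT) n :=
  [forall x, forall y, a (n y) == a y * ((a x)^-1 * a (n x))].

Lemma translationP (eT : finGroupType) (a : gT -> eT) n :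
  reflect (translation a n) (translationb a n).
Proof.
by apply: (iffP 'forall_forallP) => trn x y; apply/eqP; apply: trn.
Qed.

Definition translation_set :=
  [set n | [&& translationb a1 n, translationb a2 n & translationb a3 n]].

Lemma translation_setP n : reflect (translations n) (n \in translation_set).
Proof.
rewrite inE; apply: (iffP and3P) => [[]|[]] n1 n2 n3; split; exact/translationP.
Qed.

Lemma translation1 (eT : finGroupType) (a : gT -> eT) : translation a 1.
Proof. by move=> x y; rewrite !perm1 mulVg mulg1. Qed.

Lemma translationM (eT : finGroupType) (a : gT -> eT) n m :
  translation a n -> translation a m -> translation a (n * m).
Proof.
move=> trn trm x y; rewrite !permM (trm (n x)) (trn x y) -!mulgA.
by congr (_ * (_ * _)); rewrite mulKVg.
Qed.

Lemma translation_group_set : group_set translation_set.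
Proof.
apply/group_setP; split; first by apply/translation_setP; split; apply: translation1.
move=> n m /translation_setP[n1 n2 n3] /translation_setP[m1 m2 m3].
by apply/translation_setP; split; apply: translationM.
Qed.
Definition translation_group := Group translation_group_set.

Lemma translation_regular : regularb translation_group.
Proof.
pose theta x := (a1 x, a2 x, a3 x).
have theta_inj : injective theta by move=> x y [e1 e2 e3]; apply: labels_inj.
have [theta_inv thetaK theta_invK] : bijective theta.
  by apply: inj_card_bij theta_inj _; rewrite !card_prod oG.
apply/'forall_forallP=> x y; apply/cards1P.
pose f z := theta_inv (a1 z * ((a1 x)^-1 * a1 y), a2 z * ((a2 x)^-1 * a2 y),
   a3 z * ((a3 x)^-1 * a3 y)).
have fE z : [/\ a1 (f z) = a1 z * ((a1 x)^-1 * a1 y),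
    a2 (f z) = a2 z * ((a2 x)^-1 * a2 y) & a3 (f z) = a3 z * ((a3 x)^-1 * a3 y)].
  by have := theta_invK (a1 z * ((a1 x)^-1 * a1 y), a2 z * ((a2 x)^-1 * a2 y),
   a3 z * ((a3 x)^-1 * a3 y)); rewrite -/(f z) => -[-> -> ->].
have f_inj : injective f.
  move=> z w eqf; have [z1 z2 z3] := fE z; have [w1 w2 w3] := fE w.
  apply: labels_inj.
  - by apply: (mulIg ((a1 x)^-1 * a1 y)); rewrite -z1 -w1 eqf.
  - by apply: (mulIg ((a2 x)^-1 * a2 y)); rewrite -z2 -w2 eqf.
  by apply: (mulIg ((a3 x)^-1 * a3 y)); rewrite -z3 -w3 eqf.
have trf : translations (perm f_inj).
  split=> z w; rewrite !permE; have [z1 z2 z3] := fE z; have [w1 w2 w3] := fE w.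
  - by rewrite w1 z1 mulKg.
  - by rewrite w2 z2 mulKg.
  by rewrite w3 z3 mulKg.
exists (perm f_inj); apply/setP=> n; rewrite [in RHS]inE inE.
apply/andP/eqP => [[/translation_setP[n1 n2 n3] /eqP nx] | ->]; last first.
  split; first exact/translation_setP.
  rewrite permE; apply/eqP/labels_inj; have [z1 z2 z3] := fE x.
  - by rewrite z1 mulKVg.
  - by rewrite z2 mulKVg.
  by rewrite z3 mulKVg.
apply/permP=> z; rewrite permE; have [z1 z2 z3] := fE z.
apply: labels_inj.
- by rewrite z1 (n1 x z) nx.
- by rewrite z2 (n2 x z) nx.
by rewrite z3 (n3 x z) nx.
Qed.

Lemma translation_right_normalized : right_normalized translation_group.
Proof.
apply/forallP=> g; rewrite inE; apply/subsetP=> _ /imsetP[n /translation_setP[n1 n2 n3] ->].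
by apply/translation_setP; split; [apply: stable1 | apply: stable2 | apply: stable3].
Qed.

Lemma translation_abelian : abelian translation_group.
Proof.
have comm (eT : finGroupType) (a : gT -> eT) n m x :
    (forall e f : eT, e * f = f * e) -> translation a n -> translation a m ->
    a (m (n x)) = a (n (m x)).
  move=> cE trn trm; rewrite (trm 1 (n x)) (trn 1 x) (trn 1 (m x)) (trm 1 x).
  by rewrite -!mulgA; congr (_ * _); rewrite mulgA cE !mulgA.
apply/centsP=> n /translation_setP[n1 n2 n3] m /translation_setP[m1 m2 m3].
apply/permP=> x; rewrite !permM; apply: labels_inj; exact: comm.
Qed.

Lemma translation_exponent e : exponent [set: eT1] %| e ->
  exponent [set: eT2] %| e -> exponent [set: eT3] %| e ->
  exponent translation_group %| e.
Proof.
move=> /exponentP e1 /exponentP e2 /exponentP e3; apply/exponentP=> n trn.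
have [n1 n2 n3] := translation_setP _ trn; apply/permP=> x.
rewrite perm1; apply: labels_inj.
- by rewrite translation_iter // e1 ?inE // mulg1.
- by rewrite translation_iter // e2 ?inE // mulg1.
by rewrite translation_iter // e3 ?inE // mulg1.
Qed.

End TranslationGroup.

(** The translation induced by n has an order that divides both the order of n, a
    pi-number, and the order of eT, a pi'-number. *)
Lemma pcore_translation1 (gT eT : finGroupType) (a : gT -> eT) (pi : nat_pred)
    (N : {group {perm gT}}) n : pi^'.-group [set: eT] -> n \in 'O_pi(N) -> translation a n ->
  a (n 1) = a 1.
Proof.
move=> piE Nn trn; set c := (a 1)^-1 * a (n 1).
suff c1 : c = 1 by rewrite (trn 1) -/c c1 mulg1.
apply/eqP; rewrite -order_eq1 -dvdn1.
have co : coprime #[n] #[c].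
  apply: (@pnat_coprime pi); first exact: mem_p_elt (pcore_pgroup pi N) Nn.
  exact: mem_p_elt piE (in_setT c).
rewrite -(eqnP co) dvdn_gcd dvdnn andbT order_dvdn; apply/eqP.
apply: (mulgI (a 1)); rewrite mulg1 -translation_iter //.
by rewrite expg_order perm1.
Qed.

(** * Regular groups correspond to triples of subgroups *)
Section CountRegularSubgroups.

Variables (p : nat) (gT : finGroupType) (P : {group gT}).
Hypotheses (p_pr : prime p) (p_gt3 : 3 < p).
Hypotheses (oG : #|gT| = (12 * p)%N) (nPG : P <| [set: gT]) (oP : #|P| = p).

Local Notation T := [set: 'Z_(6 * p) * 'Z_2]%G.

Definition subgroups_of_order d := [set H : {group gT} | #|H| == d].

(** The triple (H_p, H_3, H_2). *)
Definition hall_orbits N :=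
  (hall_orbit p^' N, hall_orbit 3^' N, hall_orbit 2^' N) : {group gT} * {group gT} * {group gT}.

Lemma partC_prime q m n : prime q -> q.-nat m -> coprime q n -> ((m * n)`_q^' = n)%N.
Proof.
move=> q_pr q_m co_qn; have [m_gt0 _] := andP q_m.
have n_gt0 : 0 < n.
  by case: n co_qn => //; rewrite /coprime gcdn0 => /eqP q1; rewrite q1 in q_pr.
rewrite partnM // part_p'nat ?pnatNK // mul1n part_pnat_id //.
by rewrite p'natE // -prime_coprime.
Qed.

Lemma parts_12p : [/\ ((12 * p)`_p^' = 12)%N, ((12 * p)`_3^' = 4 * p)%N &
  ((12 * p)`_2^' = 3 * p)%N].
Proof.
have co := coprime_p12 p_pr p_gt3.
have p2 : coprime 2 p by move: co; rewrite coprime_sym -[12]/(2 * 6)%N coprimeMl => /andP[].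
have p3 : coprime 3 p by move: co; rewrite coprime_sym -[12]/(3 * 4)%N coprimeMl => /andP[].
split.
- by rewrite mulnC partC_prime ?pnat_id.
- by rewrite -[12]/(3 * 4)%N -mulnA partC_prime // coprimeMr p3.
by rewrite -[12]/(4 * 3)%N -mulnA partC_prime // coprimeMr p2.
Qed.

Lemma familyP (N : {group {perm gT}}) : reflect
  [/\ regularb N, right_normalized N, abelian N & exponent N %| 6 * p]
  (N \in regular_subgroups gT T).
Proof.
rewrite inE isog_Zp_pair //; apply: (iffP and3P) => [[regN normN /and3P[]] //| [regN normN cNN eN]].
by split; rewrite // cNN eN (regular_card regN) oG eqxx.
Qed.

Lemma hall_orbits_card N : N \in regular_subgroups gT T ->
  [/\ #|hall_orbit p^' N| = 12, #|hall_orbit 3^' N| = (4 * p)%N &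
  #|hall_orbit 2^' N| = (3 * p)%N].
Proof.
case/familyP=> regN normN cNN _; have [e1 e2 e3] := parts_12p.
by split; rewrite card_hall_orbit // oG.
Qed.

Lemma mem_pcore_abelian (aT : finGroupType) (N : {group aT}) pi n :
  abelian N -> n \in N -> pi.-elt n -> n \in 'O_pi(N).
Proof.
move=> cNN Nn pi_n.
by rewrite (mem_normal_Hall (nilpotent_pcore_Hall pi (abelian_nil cNN)) (pcore_normal _ _)).
Qed.

Lemma complement_12 (H : {group gT}) : #|H| = 12 -> H * P = [set: gT] /\ H :&: P = 1.
Proof.
move=> oH; have tiHP : H :&: P = 1.
  by apply: coprime_TIg; rewrite oH oP coprime_sym coprime_p12.
split=> //; apply/eqP; rewrite eqEcard subsetT /= cardsT oG TI_cardMg // oH oP.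
exact: leqnn.
Qed.

(** A translation by P and the Sylow p-subgroup of N, of order p, generate a group
    of order dividing p^2, which is abelian. *)
Lemma family_centralizes N u n : N \in regular_subgroups gT T -> u \in P ->
  n \in N -> n ^ rmul u \in 'O_p^'(N) :* n.
Proof.
case/familyP=> regN normN cNN _ Pu Nn.
have [_ defN _ _] := dprodP (nilpotent_pcoreC p (abelian_nil cNN)).
have /mulsgP[q m Qq Mm ->] : n \in 'O_p(N) * 'O_p^'(N) by rewrite defN.
have oQ : #|'O_p(N)| = p.
  rewrite (card_Hall (nilpotent_pcore_Hall p (abelian_nil cNN))) regular_card //.
  have p'12 : p^'.-nat 12 by rewrite p'natE // -prime_coprime // coprime_p12.
  by rewrite oG partnM ?(prime_gt0 p_pr) // (part_p'nat p'12) mul1n part_pnat_id ?pnat_id.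
have or : #[rmul u] %| p.
  rewrite order_dvdn; apply/eqP.
  have -> : rmul u ^+ p = rmul (u ^+ p).
    elim: {1 2}p => [|k IHk]; last by rewrite !expgS rmulM IHk.
    by apply/permP=> x; rewrite rmulE perm1 mulg1.
  have /eqP -> : u ^+ p == 1 by rewrite -order_dvdn -oP order_dvdG.
  by apply/permP=> x; rewrite rmulE perm1 mulg1.
have nQr : <[rmul u]> \subset 'N('O_p(N)).
  by rewrite cycle_subG; apply: (forallP (normed_pcore p normN)).
have cQr : abelian ('O_p(N) <*> <[rmul u]>).
  apply: (@p2group_abelian _ p).
    rewrite /= norm_joinEr // pgroupM pcore_pgroup /=.
    by apply: (pnat_dvd or); rewrite pnat_id.
  rewrite /= norm_joinEr // -[X in _ <= X](pfactorK 2 p_pr) dvdn_leq_log ?expn_gt0 ?prime_gt0 //.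
  have dvdQr : #|'O_p(N) * <[rmul u]>| %| #|'O_p(N)| * #[rmul u].
    by rewrite orderE mul_cardG dvdn_mulr.
  by apply: dvdn_trans dvdQr _; rewrite oQ dvdn_pmul2l ?prime_gt0.
have cqr : q ^ rmul u = q.
  apply/conjg_fixP/commgP; apply: (centsP cQr).
    by rewrite (subsetP (joing_subl _ _)).
  by rewrite (subsetP (joing_subr _ _)) ?cycle_id.
have Mmr : m ^ rmul u \in 'O_p^'(N) by rewrite right_normalizedJ // normed_pcore.
apply/rcosetP; exists (m ^ rmul u * m^-1); first by rewrite groupM ?groupV.
have sON pi x : x \in 'O_pi(N) -> x \in N by apply: subsetP (pcore_sub pi N) x.
have cNq z : z \in 'O_p^'(N) -> q * z = z * q.
  by move=> Mz; apply: (centsP cNN q (sON _ _ Qq) z (sON _ _ Mz)).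
by rewrite conjMg cqr !cNq // mulgA mulgKV.
Qed.

(** On the cosets of H_3 and H_2 the permutations n^3 and n^2 are trivial, because
    the exponent of N divides 6p. *)
Lemma family_translations N (a1 : gT -> subg_of P) (a2 : gT -> 'Z_3)
    (a3 : gT -> 'Z_2 * 'Z_2) n :
    N \in regular_subgroups gT T -> a1 = complement_label P (hall_orbit p^' N) ->
    coset_label (hall_orbit 3^' N) a2 -> coset_label (hall_orbit 2^' N) a3 ->
  n \in N -> translations a1 a2 a3 n.
Proof.
move=> famN -> label2 label3 Nn; have [regN normN cNN eN] := familyP _ famN.
have [o1 o2 o3] := hall_orbits_card famN.
have [HP tiHP] := complement_12 o1.
have cPP : abelian P by rewrite cyclic_abelian ?prime_cyclic ?oP.
have order_n m k : (m * k = 6 * p)%N -> #[n ^+ m] %| k.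
  move=> mk; rewrite order_dvdn -expgM mk; apply/eqP.
  exact: (exponentP eN).
split.
- apply: (label_translation_normal normN cNN
    (complement_coset_label HP tiHP) (P := gval P) (phi := subg P)) => //.
  + by move=> e f; apply: subg_inj; rewrite /= (centsP cPP) ?subgP.
  + by move=> x u Pu; apply: complement_labelM.
  + by move=> e; exists (sgval e); rewrite ?subgP ?sgvalK.
  by move=> u Pu; apply: family_centralizes; rewrite ?groupV.
- apply: (label_translation3 regN normN cNN label2); rewrite ?card_ord //.
  apply: mem_pcore_abelian; rewrite ?groupX //.
  apply: (pnat_dvd (order_n 3 (2 * p)%N _)); first by rewrite mulnA.
  rewrite pnatM p'natE // -prime_coprime // /=.
  by rewrite p'natE // dvdn_prime2 // neq_ltn p_gt3.
apply: (label_translation4 regN normN cNN label3); rewrite ?card_prod ?card_ord //.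
- case=> e f; congr pair; apply/val_inj; case: e => [[|[|//]]] //; case: f => [[|[|//]]] //.
apply: mem_pcore_abelian; rewrite ?groupX //.
apply: (pnat_dvd (order_n 2 (3 * p)%N _)); first by rewrite mulnA.
rewrite pnatM p'natE // -prime_coprime // /=.
by rewrite p'natE // dvdn_prime2 // neq_ltn (ltn_trans _ p_gt3).
Qed.

Lemma hall_triple_TI (H1 H2 H3 : {group gT}) : #|H1| = 12 -> #|H2| = (4 * p)%N ->
  #|H3| = (3 * p)%N -> H1 :&: H2 :&: H3 = 1.
Proof.
move=> o1 o2 o3; apply/trivgP; rewrite -(@card_le1_trivg _ (H1 :&: H2 :&: H3)%G) //.
set I := (H1 :&: H2 :&: H3)%G.
have d1 : #|I| %| 12 by rewrite -o1 cardSg // /I /= -setIA subsetIl.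
have d2 : #|I| %| 4 * p by rewrite -o2 cardSg // /I /= -setIA setICA subsetIl.
have d3 : #|I| %| 3 * p by rewrite -o3 cardSg // /I /= subsetIr.
have co := coprime_p12 p_pr p_gt3.
have coI : coprime #|I| p by rewrite coprime_sym (coprime_dvdr d1).
rewrite Gauss_dvdl // in d2; rewrite Gauss_dvdl // in d3.
have : #|I| %| gcdn 4 3 by rewrite dvdn_gcd d2.
by rewrite dvdn1 => /eqP->.
Qed.

Lemma card_Zp2 : #|{: 'Z_2 * 'Z_2}| = 4.
Proof. by rewrite card_prod !card_ord. Qed.

Lemma expg_Zp2 (e : 'Z_2 * 'Z_2) : e ^+ 2 = 1.
Proof.
case: e => e f; congr pair; apply/val_inj; first by case: e => [[|[|//]]].
by case: f => [[|[|//]]].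
Qed.

Lemma label_orders (H2 H3 : {group gT}) : #|H2| = (4 * p)%N -> #|H3| = (3 * p)%N ->
  #|gT| = (#|'Z_3| * #|H2|)%N /\ #|gT| = (#|{: 'Z_2 * 'Z_2}| * #|H3|)%N.
Proof. by move=> o2 o3; rewrite card_Zp2 card_ord o2 o3 oG !mulnA. Qed.

(** Elements of N and N' with the same value at 1 induce the same translations for
    the labels of the common triple, so they are equal. *)
Lemma hall_orbits_inj : {in regular_subgroups gT T &, injective hall_orbits}.
Proof.
move=> N N' famN famN' eqO.
have eq1 : hall_orbit p^' N = hall_orbit p^' N' := congr1 (fun t => t.1.1) eqO.
have eq2 : hall_orbit 3^' N = hall_orbit 3^' N' := congr1 (fun t => t.1.2) eqO.
have eq3 : hall_orbit 2^' N = hall_orbit 2^' N' := congr1 (fun t => t.2) eqO.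
have [regN _ _ _] := familyP _ famN; have [regN' _ _ _] := familyP _ famN'.
have [o1 o2 o3] := hall_orbits_card famN.
have [HP tiHP] := complement_12 o1; have [oG2 oG3] := label_orders o2 o3.
have [a2 label2] := exists_label oG2; have [a3 label3] := exists_label oG3.
have label1 := complement_coset_label HP tiHP.
have tiH := hall_triple_TI o1 o2 o3.
apply/val_inj/eqP; rewrite eqEcard /= !regular_card // leqnn andbT.
apply/subsetP=> n Nn; have [m Nm eq_mn] := regular_trans regN' 1 (n 1).
have trn := family_translations famN erefl label2 label3 Nn.
rewrite (translations_eq label1 label2 label3 tiH trn _ (esym eq_mn)) //.
by apply: (family_translations famN'); rewrite -?eq1 -?eq2 -?eq3.
Qed.

(** The group of all permutations inducing translations on the three coset spaces
    has the given triple: the inclusions hold by pcore_translation1, and the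
    orders agree. *)
Lemma hall_orbits_surj (H1 H2 H3 : {group gT}) : #|H1| = 12 -> #|H2| = (4 * p)%N ->
    #|H3| = (3 * p)%N ->
  exists2 N, N \in regular_subgroups gT T & hall_orbits N = (H1, H2, H3).
Proof.
move=> o1 o2 o3.
have [HP tiHP] := complement_12 o1; have [oG2 oG3] := label_orders o2 o3.
have [a2 label2] := exists_label oG2; have [a3 label3] := exists_label oG3.
have label1 := complement_coset_label HP tiHP.
have tiH := hall_triple_TI o1 o2 o3.
have cPP : abelian P by rewrite cyclic_abelian ?prime_cyclic ?oP.
have cE1 (e f : subg_of P) : e * f = f * e.
  by apply: subg_inj; rewrite /= (centsP cPP) ?subgP.
have cE2 (e f : 'Z_3) : e * f = f * e by apply: addrC.
have cE3 (e f : 'Z_2 * 'Z_2) : e * f = f * e by apply: addrC.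
have oE1 : #|{: subg_of P}| = p by rewrite -cardsT -oP (card_isog (isog_subg P)).
have oE : #|gT| = (#|{: subg_of P}| * #|'Z_3| * #|{: 'Z_2 * 'Z_2}|)%N.
  by rewrite oE1 card_Zp2 card_ord oG -mulnA mulnC.
have stable1 := complement_stable cPP nPG HP tiHP.
have stable2 := stable_label3 label2 (card_ord 3).
have stable3 := stable_label4 label3 card_Zp2 expg_Zp2.
pose N := translation_group (complement_label P H1) a2 a3.
have trN n : n \in N -> translations (complement_label P H1) a2 a3 n.
  by move/translation_setP.
have famN : N \in regular_subgroups gT T.
  apply/familyP; split.
  - exact: (translation_regular label1 label2 label3 tiH oE).
  - exact: (translation_right_normalized stable1 stable2 stable3).
  - exact: (translation_abelian label1 label2 label3 tiH cE1 cE2 cE3).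
  apply: (translation_exponent label1 label2 label3 tiH).
  - by apply: dvdn_trans (exponent_dvdn _) _; rewrite cardsT oE1 dvdn_mull.
  - apply: dvdn_trans (exponent_dvdn _) _; rewrite cardsT card_ord.
    by rewrite dvdn_mulr.
  apply: (@dvdn_trans 2); last by rewrite dvdn_mulr.
  by apply/exponentP=> e _; apply: expg_Zp2.
exists N => //; have [regN normN cNN _] := familyP _ famN.
have [c1 c2 c3] := hall_orbits_card famN.
have co := coprime_p12 p_pr p_gt3.
congr (_, _, _); apply/group_inj/eqP; rewrite eqEcard ?c1 ?c2 ?c3 ?o1 ?o2 ?o3 leqnn andbT.
- rewrite hall_orbitE //; apply/subsetP=> _ /imsetP[n On ->].
  have [tr1 _ _] := trN n (subsetP (pcore_sub _ _) n On).
  have := label1 (n 1) 1; rewrite invg1 mulg1 => <-; apply/eqP; apply: pcore_translation1 _ On tr1.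
  by rewrite /pgroup cardsT oE1 pnatNK pnat_id.
- rewrite hall_orbitE //; apply/subsetP=> _ /imsetP[n On ->].
  have [_ tr2 _] := trN n (subsetP (pcore_sub _ _) n On).
  have := label2 (n 1) 1; rewrite invg1 mulg1 => <-; apply/eqP; apply: pcore_translation1 _ On tr2.
  by rewrite /pgroup cardsT card_ord.
rewrite hall_orbitE //; apply/subsetP=> _ /imsetP[n On ->].
have [_ _ tr3] := trN n (subsetP (pcore_sub _ _) n On).
have := label3 (n 1) 1; rewrite invg1 mulg1 => <-; apply/eqP; apply: pcore_translation1 _ On tr3.
by rewrite /pgroup cardsT card_Zp2.
Qed.

Theorem card_regular_subgroups : #|regular_subgroups gT T| =
  (#|subgroups_of_order 12| * #|subgroups_of_order (4 * p)|
     * #|subgroups_of_order (3 * p)|)%N.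
Proof.
rewrite -!cardsX -(card_in_imset hall_orbits_inj); congr #|pred_of_set _|.
apply/setP=> -[[H1 H2] H3]; rewrite !inE /=; apply/imsetP/idP.
  by case=> N /hall_orbits_card[o1 o2 o3] [-> -> ->]; rewrite o1 o2 o3 !eqxx.
case/andP=> /andP[/eqP o1 /eqP o2] /eqP o3.
by have [N famN eqN] := hall_orbits_surj o1 o2 o3; exists N.
Qed.

End CountRegularSubgroups.

(** * Subgroups of Z_p x| F of order 12, 4p and 3p *)
Section SubgroupCounts.

Variables (p : nat) (gT : finGroupType) (P C : {group gT}).
Hypotheses (p_pr : prime p) (p_gt3 : 3 < p).
Hypotheses (defG : P ><| C = [set: gT]) (oP : #|P| = p) (oC : #|C| = 12).

Let co_PC : coprime #|P| #|C|.
Proof. by rewrite oP oC coprime_p12. Qed.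

Let nPG : P <| [set: gT].
Proof. by case/sdprod_context: defG. Qed.

Let nPC : C \subset 'N(P).
Proof. by case/sdprodP: defG. Qed.

Let defPC : P * C = [set: gT].
Proof. by case/sdprodP: defG. Qed.

Let tiPC : P :&: C = 1.
Proof. by case/sdprodP: defG. Qed.

Let p'12 : p^'.-nat 12.
Proof. by rewrite p'natE // -prime_coprime // coprime_p12. Qed.

Let oG : #|[set: gT]| = (p * 12)%N.
Proof. by rewrite -defPC coprime_cardMg // oP oC. Qed.

Let oGp : ((p * 12)`_p = p)%N.
Proof.
by rewrite partnM ?(prime_gt0 p_pr) // part_pnat_id ?pnat_id // part_p'nat ?muln1.
Qed.

Let oGp' : ((p * 12)`_p^' = 12)%N.
Proof.
rewrite partnM ?(prime_gt0 p_pr) // part_p'nat ?mul1n ?part_pnat_id //.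
by rewrite pnatNK pnat_id.
Qed.

Lemma card_complements_central :
  C \subset 'C(P) -> #|@subgroups_of_order gT 12| = 1%N.
Proof.
move=> cPC; suff -> : @subgroups_of_order gT 12 = [set C] by rewrite cards1.
apply/setP=> H; rewrite !inE; apply/eqP/eqP => [oH | -> //].
have nCG : C <| [set: gT].
  by rewrite /normal subsetT -defPC mulG_subG normG andbT cents_norm // centsC.
have hallC : p^'.-Hall([set: gT]) C.
  by rewrite pHallE subsetT /= oG oC oGp'.
apply/group_inj/eqP; rewrite eqEcard oH oC leqnn andbT.
by rewrite (sub_normal_Hall hallC nCG) ?subsetT // /pgroup oH.
Qed.

(** Complements are conjugate under P by Schur-Zassenhaus. If a nontrivial element
    of P normalized C, then so would P, and P and C would centralize each
    other. *)
Lemma card_complements :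
  ~~ (C \subset 'C(P)) -> #|@subgroups_of_order gT 12| = p.
Proof.
move=> not_cPC; rewrite -oP.
have solP : solvable P by rewrite abelian_sol ?cyclic_abelian ?prime_cyclic ?oP.
have -> : @subgroups_of_order gT 12 = [set (C :^ x)%G | x in P].
  apply/setP=> H; rewrite inE; apply/eqP/imsetP => [oH | [x Px ->]]; last first.
    by rewrite cardJg.
  have sHPC : H \subset P * C by rewrite defPC subsetT.
  have [x Px defH] :=
    SchurZassenhaus_trans_sol solP nPC sHPC co_PC (etrans oH (esym oC)).
  by exists x => //; apply: group_inj.
rewrite card_in_imset // => x y Px Py /(congr1 val) /= eqC.
apply/eqP; rewrite eq_mulgV1; apply: contraR not_cPC => xy1.
have Pz : x * y^-1 \in P by rewrite groupM ?groupV.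
have nCz : x * y^-1 \in 'N(C).
  by rewrite inE conjsgM eqC -conjsgM mulgV conjsg1.
have defP : <[x * y^-1]> = P.
  apply/eqP; rewrite eqEcard cycle_subG Pz /= oP.
  have := order_dvdG Pz; rewrite oP => /(prime_nt_dvdP p_pr) <- //.
  by rewrite order_eq1.
have nCP : P \subset 'N(C) by rewrite -defP cycle_subG.
by apply/commG1P/trivgP; rewrite -tiPC subsetI commg_subr nPC commg_subl nCP.
Qed.

(** A subgroup H of order m p contains the normal Sylow subgroup P, hence
    H = P (H :&: C), where H :&: C is a Sylow subgroup of C. *)
Lemma card_subgroups_over q m : prime q -> (12`_q)%N = m ->
  #|@subgroups_of_order gT (m * p)%N| = #|'Syl_q(C)|.
Proof.
move=> q_pr m_def.
have sylP : p.-Sylow([set: gT]) P.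
  by rewrite pHallE subsetT /= oG oP oGp.
have sylE D : (D \in 'Syl_q(C)) = (D \subset C) && (#|D| == m).
  by rewrite inE pHallE oC m_def.
have over_card (D : {group gT}) : D \subset C -> #|P <*> D| = (p * #|D|)%N.
  move=> sDC; rewrite norm_joinEr ?(subset_trans sDC) //.
  by rewrite (coprime_cardMg (coprimegS sDC co_PC)) oP.
have capE (D : {group gT}) : D \subset C -> (P <*> D) :&: C = D.
  move=> sDC; rewrite norm_joinEr ?(subset_trans sDC) //.
  by rewrite setIC -group_modr // setIC tiPC mul1g.
suff -> : @subgroups_of_order gT (m * p)%N = [set (P <*> D)%G | D : {group gT} in 'Syl_q(C)].
  rewrite card_in_imset // => D D'; rewrite !sylE => /andP[sDC _] /andP[sDC' _].
  move/(congr1 val) => /= eqPD; apply: group_inj.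
  by rewrite -(capE D sDC) eqPD capE.
apply/setP=> H; rewrite inE; apply/eqP/imsetP => [oH | [D]]; last first.
  by rewrite sylE => /andP[sDC /eqP oD] ->; rewrite over_card // oD mulnC.
have [Q sylQ] := Sylow_exists p H.
have sQP : Q \subset P.
  by rewrite (sub_normal_Hall sylP nPG) ?subsetT // (pHall_pgroup sylQ).
have sPH : P \subset H.
  suff -> : P :=: Q by apply: pHall_sub sylQ.
  apply/eqP; rewrite eq_sym eqEcard sQP oP (card_Hall sylQ) oH dvdn_leq //.
  by rewrite -{1}(part_pnat_id (pnat_id p_pr)) partn_dvd ?dvdn_mull // -oH cardG_gt0.
have defH : P <*> (H :&: C) = H.
  rewrite norm_joinEr /= ?(subset_trans (subsetIr H C)) // setIC.
  by rewrite group_modl // defPC setTI.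
exists (H :&: C)%G; last by apply: group_inj; rewrite /= defH.
rewrite sylE subsetIr -(eqn_pmul2l (prime_gt0 p_pr)) -over_card ?subsetIr //=.
by rewrite defH oH mulnC.
Qed.

End SubgroupCounts.

(** * Sylow subgroups of the groups of order 12 *)
Section Order12.

Variables (gT : finGroupType) (A : {group gT}).
Hypothesis oA : #|A| = 12.

Lemma part12 : (12`_2 = 4)%N /\ (12`_3 = 3)%N.
Proof. by rewrite !p_part. Qed.

Lemma card_Syl_core q : prime q -> #|'O_q(A)| = (12`_q)%N -> #|'Syl_q(A)| = 1%N.
Proof.
move=> q_pr oQ; have sylQ : q.-Sylow(A) 'O_q(A).
  by rewrite pHallE pcore_sub oA oQ /=.
rewrite (card_Syl sylQ); apply/eqP; rewrite indexg_eq1 subsetI subxx.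
exact/normal_norm/pcore_normal.
Qed.

Lemma abelian_card_Syl q : prime q -> abelian A -> #|'Syl_q(A)| = 1%N.
Proof.
move=> q_pr cAA; apply: card_Syl_core => //.
by rewrite (card_Hall (nilpotent_pcore_Hall q (abelian_nil cAA))) oA.
Qed.

Lemma card_Syl1_core q : #|'Syl_q(A)| = 1%N ->
  q.-Sylow(A) 'O_q(A) /\ 'O_q(A) <| A.
Proof.
move=> n1; have [Q sylQ] := Sylow_exists q A.
have nQA : Q <| A.
  rewrite /normal (pHall_sub sylQ) /=; have := card_Syl sylQ.
  by rewrite n1 => /esym/eqP; rewrite indexg_eq1 subsetI => /andP[].
by rewrite (normal_Hall_pcore sylQ nQA).
Qed.

Lemma dvd12_cases n : n %| 12 -> n \in [:: 1; 2; 3; 4; 6; 12]%N.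
Proof. by rewrite dvdn_divisors. Qed.

(** If both Sylow subgroups are normal then A is their direct product, and it is
    abelian as they have orders 3 and 4. Sylow's congruences leave one other
    possibility for each number. *)
Lemma nonabelian_card_Syl : ~~ abelian A ->
  (#|'O_3(A)| = 3 -> #|'Syl_3(A)| = 1%N /\ #|'Syl_2(A)| = 3) /\
  (#|'O_2(A)| = 4 -> #|'Syl_3(A)| = 4 /\ #|'Syl_2(A)| = 1%N).
Proof.
move=> not_cAA; have [part2 part3] := part12.
have not11 : #|'Syl_3(A)| = 1%N -> #|'Syl_2(A)| = 1%N -> False.
  move=> /card_Syl1_core[syl3 n3] /card_Syl1_core[syl2 n2].
  have o3 : #|'O_3(A)| = 3 by rewrite (card_Hall syl3) oA part3.
  have o2 : #|'O_2(A)| = 4 by rewrite (card_Hall syl2) oA part2.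
  have ti : 'O_3(A) :&: 'O_2(A) = 1 by apply: coprime_TIg; rewrite o3 o2.
  have defA : 'O_3(A) * 'O_2(A) = A.
    apply/eqP; rewrite eqEcard TI_cardMg // o3 o2 oA leqnn andbT.
    by rewrite mul_subG ?pcore_sub.
  have nO q r : 'O_q(A) \subset 'N('O_r(A)).
    exact: subset_trans (pcore_sub _ _) (normal_norm (pcore_normal _ _)).
  case/negP: not_cAA; rewrite -defA abelianM.
  rewrite cyclic_abelian ?prime_cyclic ?o3 //=.
  rewrite (@card_p2group_abelian _ 2) ?o2 //= centsC.
  apply/commG1P/trivgP; rewrite -ti subsetI commg_subl commg_subr.
  by rewrite !nO.
have dvd2 : #|'Syl_2(A)| %| 12 by rewrite -oA card_Syl_dvd.
have dvd3 : #|'Syl_3(A)| %| 12 by rewrite -oA card_Syl_dvd.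
have mod2 := card_Syl_mod A (isT : prime 2).
have mod3 := card_Syl_mod A (isT : prime 3).
split=> oO; first split.
- by apply: card_Syl_core; rewrite ?part3.
- have n3 := card_Syl_core (isT : prime 3) (etrans oO (esym part3)).
  move: mod2 (not11 n3) (dvd12_cases dvd2); rewrite !inE.
  by move=> mod2 n1 /or4P[|||/or3P[]] /eqP e; rewrite e // in mod2 n1 *.
split; last by apply: card_Syl_core; rewrite ?part2.
have n2 := card_Syl_core (isT : prime 2) (etrans oO (esym part2)).
move: mod3 (dvd12_cases dvd3) => mod3; rewrite !inE.
move=> /or4P[/eqP e | ||/or3P[]]; first by case: (not11 e n2).
all: by move/eqP=> e; rewrite e // in mod3 *.
Qed.

End Order12.

(** * The possible kernels *)
Section SmallGroups.

Implicit Type aT : finGroupType.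

Lemma isog_Zp_card aT (A : {group aT}) n : 1 < n ->
  A \isog [set: 'Z_n] = cyclic A && (#|A| == n).
Proof.
move=> n1; have cycZ : cyclic [set: 'Z_n].
  by apply/cyclicP; exists Zp1; rewrite -(Zp_cycle (Zp_trunc n).+1).
have oZ : #|[set: 'Z_n]| = n by rewrite cardsT card_ord Zp_cast.
by rewrite isog_sym isog_cyclic_card // oZ.
Qed.

Lemma abelian6_cyclic aT (A : {group aT}) : abelian A -> #|A| = 6 -> cyclic A.
Proof.
move=> cAA oA; have [x Ax ex] := exponent_witness (abelian_nil cAA).
have dvd_e q : prime q -> q %| 6 -> q %| exponent A.
  move=> q_pr q6; have : q \in \pi(A) by rewrite mem_primes q_pr /= oA.
  by rewrite -pi_of_exponent mem_primes => /and3P[].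
have : 6 %| exponent A by rewrite (@Gauss_dvd 2 3) // !dvd_e.
rewrite ex => d6; apply/cyclicP; exists x; apply/eqP; rewrite eq_sym eqEcard.
by rewrite cycle_subG Ax -orderE oA dvdn_leq ?order_gt0.
Qed.

Lemma abelem_Zp2 : 2.-abelem [set: 'Z_2 * 'Z_2].
Proof. by apply/exponent2_abelem/exponentP=> e _; apply: expg_Zp2. Qed.

Lemma isog_Zp2 aT (A : {group aT}) : #|A| = 4 ->
  (forall x, x \in A -> x ^+ 2 = 1) -> A \isog [set: 'Z_2 * 'Z_2].
Proof.
move=> oA expA; rewrite isog_sym (isog_abelem_card _ abelem_Zp2).
by rewrite cardsT card_Zp2 oA eqxx andbT; apply/exponent2_abelem/exponentP.
Qed.

(** The group is generated by two conjugate involutions: if the conjugates of u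
    under an element t of order 3 were equal, u and t would commute and generate
    an abelian group of order 6. *)
Lemma nonabelian6_dihedral aT (A : {group aT}) :
  #|A| = 6 -> ~~ abelian A -> A \isog 'D_6.
Proof.
move=> oA not_cAA.
have [|u Au ou] := @Cauchy _ 2 A isT; first by rewrite oA.
have [|t At ot] := @Cauchy _ 3 A isT; first by rewrite oA.
have ti : <[t]> :&: <[u]> = 1 by apply: coprime_TIg; rewrite -!orderE ou ot.
have defA : <[t]> * <[u]> = A.
  apply/eqP; rewrite eqEcard TI_cardMg // -!orderE ou ot oA leqnn andbT.
  by rewrite mul_subG ?cycle_subG.
have not_cut : u ^ t != u.
  apply: contra not_cAA => /eqP cut; rewrite -defA abelianM !cycle_abelian /=.
  rewrite cycle_subG /= cent_cycle; apply/cent1P/commgP/conjg_fixP.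
  by [].
pose G := <<[set u; u ^ t]>>%G.
have sGA : G \subset A by rewrite gen_subG subUset !sub1set Au groupJ.
have isoG : G \isog 'D_#|G| by apply: involutions_gen_dihedral; rewrite ?orderJ // eq_sym.
suff oG : #|G| = 6 by rewrite -oG; have -> : A = G by apply/group_inj/eqP; rewrite eq_sym eqEcard sGA oA oG.
have d6 : #|G| %| 6 by rewrite -oA cardSg.
have d2 : 2 %| #|G| by rewrite -ou order_dvdG // mem_gen ?set21.
have g3 : 2 < #|G|.
  have sG : [set 1; u; u ^ t] \subset G.
    by rewrite !subUset !sub1set group1 !mem_gen ?set21 ?set22.
  apply: leq_trans (subset_leq_card sG); rewrite setUC cardsU1 !inE cards2.
  have u1 : u != 1 by rewrite -order_gt1 ou.
  by rewrite negb_or conjg_eq1 u1 not_cut eq_sym u1.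
by move: d6 d2 g3; case: #|G| => [|[|[|[|[|[|[|n]]]]]]] //; move/(@dvdn_leq _ 6 isT).
Qed.

End SmallGroups.

(** A Klein group {1, v, w, v w} whose involutions are permuted cyclically
    by c. *)
Definition tetrahedral (aT : finGroupType) (A : {group aT}) (v w c : aT) :=
  [/\ [/\ v \in A, w \in A & c \in A], [/\ v ^+ 2 = 1, w ^+ 2 = 1 & c ^+ 3 = 1],
      [/\ v != 1, w != 1 & v != w], commute v w & v ^ c = w /\ w ^ c = v * w].

(** v = (0 1)(2 3), w = (0 2)(1 3) and c = (1 2 3). *)
Lemma Alt4_tetrahedral : exists v w c, tetrahedral 'Alt_('I_4)%G v w c.
Proof.
pose i n : 'I_4 := inord n.
have i_neq m n : m < 4 -> n < 4 -> m != n -> i m != i n.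
  by move=> m4 n4; rewrite -(inj_eq val_inj) /= !inordK.
have i_case (P : 'I_4 -> Prop) : P (i 0%N) -> P (i 1%N) -> P (i 2) -> P (i 3) ->
    forall x, P x.
  move=> P0 P1 P2 P3 x; rewrite -(inord_val x).
  by case: x => [[|[|[|[|//]]]] ?] /=.
pose v := tperm (i 0%N) (i 1%N) * tperm (i 2) (i 3).
pose w := tperm (i 0%N) (i 2) * tperm (i 1%N) (i 3).
pose c := tperm (i 1%N) (i 2) * tperm (i 1%N) (i 3).
have tE m n q : m < 4 -> n < 4 -> q < 4 ->
    tperm (i m) (i n) (i q) = i (if q == m then n else if q == n then m else q).
  move=> m4 n4 q4; rewrite permE /= -!(inj_eq val_inj) /= !inordK //.
  by case: ifP => //; case: ifP.
exists v, w, c; split.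
- by rewrite !Alt_even !odd_permM !odd_tperm !i_neq.
- split; apply/permP; apply: i_case; rewrite !expgS expg0 !permM ?perm1 !tE //.
- split; apply/eqP=> /permP/(_ (i 0%N)); rewrite ?permM ?perm1 !tE //;
  by move/(congr1 val); rewrite /= !inordK.
- by apply/permP; apply: i_case; rewrite !permM !tE.
by split; apply/(mulgI c); rewrite -conjgC; apply/permP; apply: i_case; rewrite !permM !tE.
Qed.

Section Order12Types.

Variables (aT : finGroupType) (A : {group aT}).
Hypothesis oA : #|A| = 12.
Implicit Type K : {group aT}.

Lemma cyclic_quotient_der1 K : K <| A -> cyclic (A / K) -> A^`(1) \subset K.
Proof.
by move=> nKA cycAK; apply: der1_min; rewrite ?normal_norm // cyclic_abelian.
Qed.

Lemma normal_core_order (q : nat) (Q : {group aT}) m :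
  Q <| A -> #|Q| = m -> (12`_q)%N = m -> #|'O_q(A)| = m.
Proof.
move=> nQA oQ m_def.
have sylQ : q.-Sylow(A) Q by rewrite pHallE normal_sub // oA m_def oQ /=.
by rewrite (normal_Hall_pcore sylQ nQA).
Qed.

Lemma sub12_order K : K \subset A -> #|K| = 12 -> K = A.
Proof. by move=> sKA oK; apply/group_inj/eqP; rewrite eqEcard sKA oA oK. Qed.

(** The Klein group V is contained in the derived subgroup, since [v, c] = v w
    and [w, c] = v, so K contains V. *)
Lemma tetrahedral_structure v w c : tetrahedral A v w c ->
  [/\ ~~ abelian A, #|'O_2(A)| = 4 &
      forall K, K <| A -> cyclic (A / K) -> K = A \/ K \isog [set: 'Z_2 * 'Z_2]].
Proof.
case=> [[Av Aw Ac] [v2 w2 c3] [v1 w1 vw] cvw [vc wc]].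
have ov : #[v] = 2 by apply: nt_prime_order.
have ow : #[w] = 2 by apply: nt_prime_order.
have oc : #[c] = 3.
  apply: nt_prime_order => //; apply: contraNneq vw => c1.
  by rewrite -vc c1 conjg1.
pose V := (<[v]> <*> <[w]>)%G.
have cVW : <[w]> \subset 'C(<[v]>) by rewrite cycle_subG /= cent_cycle; apply/cent1P.
have defV : V :=: <[v]> * <[w]> by rewrite /= cent_joinEr.
have ti : <[v]> :&: <[w]> = 1.
  apply: prime_TIg; first by rewrite -orderE ov.
  by rewrite cycle_subG /= (cycle2g ow) !inE negb_or v1.
have oV : #|V| = 4 by rewrite defV TI_cardMg // -!orderE ov ow.
have expV z : z \in V -> z ^+ 2 = 1.
  rewrite defV => /mulsgP[a b va wb ->].
  have cab : commute a b := esym (centsP cVW b wb a va).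
  rewrite expgMn //; have -> : a ^+ 2 = 1 by apply/eqP; rewrite -order_dvdn -ov order_dvdG.
  by rewrite mul1g; apply/eqP; rewrite -order_dvdn -ow order_dvdG.
have Vv : v \in V by rewrite (subsetP (joing_subl _ _)) ?cycle_id.
have Vw : w \in V by rewrite (subsetP (joing_subr _ _)) ?cycle_id.
have nVc : c \in 'N(V).
  rewrite inE /= joing_idl joing_idr -genJ gen_subG conjUg !conjg_set1 vc wc.
  by rewrite subUset !sub1set /= -joing_idl -joing_idr Vw groupM.
have sVA : V \subset A by rewrite join_subG !cycle_subG Av.
have defA : V * <[c]> = A.
  apply/eqP; rewrite eqEcard mul_subG ?cycle_subG // oA TI_cardMg; first by rewrite oV -orderE oc.
  by apply: coprime_TIg; rewrite oV -orderE oc.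
have nVA : V <| A.
  by rewrite /normal sVA -defA mul_subG ?normG ?cycle_subG.
have invv : v^-1 = v by apply/eqP; rewrite eq_invg_mul; apply/eqP.
have invw : w^-1 = w by apply/eqP; rewrite eq_invg_mul; apply/eqP.
have sVA' : V \subset A^`(1).
  have A'vw : v * w \in A^`(1) by rewrite -vc -{1}invv -commgEl mem_commg.
  have A'v : v \in A^`(1).
    have <- : [~ w, c] = v by rewrite commgEl wc invw cvw mulgA -[w * w]/(w ^+ 2) w2 mul1g.
    by rewrite mem_commg.
  rewrite join_subG !cycle_subG A'v -(mulKg v w) invv.
  by rewrite groupM.
split.
- apply: contra vw => cAA; rewrite -vc; apply/eqP/esym/conjg_fixP/commgP.
  exact: (centsP cAA).
- by apply: (normal_core_order nVA oV); rewrite part12.1.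
move=> K nKA cycAK; have sVK := subset_trans sVA' (cyclic_quotient_der1 nKA cycAK).
have d12 : #|K| %| 12 by rewrite -oA cardSg // normal_sub.
have d4 : 4 %| #|K| by rewrite -oV cardSg.
have /or3P[]: [|| #|K| == 4, #|K| == 12 | false].
- by move: (dvd12_cases d12) d4; rewrite !inE => /or4P[|||/or3P[]] /eqP->.
- move/eqP=> oK; right; have -> : K :=: V by apply/eqP; rewrite eq_sym eqEcard sVK oV oK.
  exact: isog_Zp2.
- by move/eqP=> oK; left; apply: sub12_order (normal_sub nKA) oK.
by [].
Qed.

Lemma metacyclic_orders x y m n : (m * n = 12)%N -> x ^+ m = 1 -> y ^+ n = 1 ->
    <[x]> <*> <[y]> = A -> y \in 'N(<[x]>) ->
  [/\ <[x]> * <[y]> = A, #[x] = m & #[y] = n].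
Proof.
move=> mn xm yn defA nxy.
have defA' : <[x]> * <[y]> = A by rewrite -defA norm_joinEr ?cycle_subG.
have m0 : 0 < m by case: m mn {xm}.
have n0 : 0 < n by case: n mn {yn}; rewrite ?muln0.
have lex : #[x] <= m by rewrite dvdn_leq // order_dvdn xm.
have ley : #[y] <= n by rewrite dvdn_leq // order_dvdn yn.
have le12 : 12 <= #[x] * #[y].
  by rewrite !orderE mul_cardG defA' oA leq_pmulr ?cardG_gt0.
split=> //; apply/eqP; rewrite eqn_leq ?lex ?ley /=.
  by rewrite -(leq_pmul2r n0) mn (leq_trans le12) // leq_mul2l ley orbT.
by rewrite -(leq_pmul2l m0) mn (leq_trans le12) // leq_mul2r lex orbT.
Qed.

(** The commutator [x, y] = x^-2 lies in K, and so does every square (x^i y)^2 = 1 or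
    (x^i)^2: a cyclic quotient A / K has order at most 2. *)
Lemma dihedral12_structure x y : <[x]> <*> <[y]> = A -> x ^+ 6 = 1 -> y ^+ 2 = 1 ->
    x ^ y = x^-1 ->
  [/\ ~~ abelian A, #|'O_3(A)| = 3 &
      forall K, K <| A -> cyclic (A / K) ->
      [\/ K = A, K \isog [set: 'Z_6] | K \isog 'D_6]].
Proof.
move=> defA x6 y2 xy.
have nxy : y \in 'N(<[x]>) by rewrite inE -cycleJ xy cycleV.
have [defA' ox oy] := metacyclic_orders (erefl 12 : 6 * 2 = 12)%N x6 y2 defA nxy.
have Ax : x \in A by rewrite -defA' (subsetP (mulG_subl _ _)) ?cycle_id.
have Ay : y \in A by rewrite -defA' (subsetP (mulG_subr _ _)) ?cycle_id.
have nxA : <[x]> <| A.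
  by rewrite /normal cycle_subG Ax -defA' mul_subG ?normG ?cycle_subG.
have nx2A : <[x ^+ 2]> <| A.
  by apply: char_normal_trans nxA; rewrite cycle_subgroup_char // cycle_subG mem_cycle.
have ox2 : #|<[x ^+ 2]>| = 3 by rewrite -orderE orderXdiv ox.
have x2n1 : x ^+ 2 != 1 by rewrite -order_dvdn ox.
split.
- apply: contra x2n1 => cAA; have : x ^ y = x.
    by apply/conjg_fixP/commgP; apply: (centsP cAA).
  by rewrite xy => e; rewrite expgS expg1 -{1}e mulVg.
- by apply: (normal_core_order nx2A ox2); rewrite part12.2.
move=> K nKA cycAK; have sA'K := cyclic_quotient_der1 nKA cycAK.
have nKsub := normal_norm nKA.
have Kx2 : x ^+ 2 \in K.
  rewrite -groupV (subsetP sA'K) //; have -> : (x ^+ 2)^-1 = [~ x, y].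
    by rewrite commgEl xy expgS expg1 invMg.
  by rewrite mem_commg.
have sqK z : z \in A -> z ^+ 2 \in K.
  rewrite -defA' => /mulsgP[_ b /cycleP[i ->]]; rewrite cycle2g // !inE => b1y ->.
  case/orP: b1y => /eqP->; first by rewrite mulg1 -expgM mulnC expgM groupX.
  suff -> : (x ^+ i * y) ^+ 2 = 1 by apply: group1.
  have yV : y^-1 = y by apply/eqP; rewrite eq_invg_mul; apply/eqP.
  rewrite expgS expg1 -mulgA -{1}yV [_ * (_ * _)]mulgA -mulgA.
  by rewrite -[y^-1 * _]/((x ^+ i) ^ y) conjXg xy expgVn mulgV.
have dK : #|A : K| %| 2.
  have /cyclicP[u defu] := cycAK.
  rewrite -card_quotient // defu -orderE order_dvdn.
  have : u \in A / K by rewrite defu cycle_id.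
  case/morphimP=> z nKz Az ->; rewrite -morphX //; apply/eqP.
  by rewrite /= coset_id ?sqK.
have oK : (#|K| * #|A : K| = 12)%N by rewrite Lagrange ?normal_sub.
move: dK oK; rewrite dvdn_divisors // !inE => /orP[] /eqP ->.
  by rewrite muln1 => oK; constructor 1; apply: sub12_order (normal_sub nKA) oK.
move/eqP; rewrite -[12]/(6 * 2)%N eqn_pmul2r // => /eqP oK.
have [cKK | ncKK] := boolP (abelian K).
  by constructor 2; rewrite isog_Zp_card // oK eqxx abelian6_cyclic.
by constructor 3; apply: nonabelian6_dihedral.
Qed.

(** The commutator [x, y^-1] is x, so K contains <[x]>. If K has index 2, it also
    contains y^2, which centralizes x, and K is cyclic of order 6. *)
Lemma dicyclic12_structure x y : <[x]> <*> <[y]> = A -> x ^+ 3 = 1 -> y ^+ 4 = 1 ->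
    y * x * y^-1 = x ^+ 2 ->
  [/\ ~~ abelian A, #|'O_3(A)| = 3 &
      forall K, K <| A -> cyclic (A / K) ->
      [\/ K = A, K \isog [set: 'Z_6] | K \isog [set: 'Z_3]]].
Proof.
move=> defA x3 y4 yx.
have xyV : x ^ y^-1 = x ^+ 2 by rewrite conjgE invgK mulgA.
have nxy : y \in 'N(<[x]>).
  rewrite -groupV inE -cycleJ xyV cycle_subG mem_cycle //.
have [defA' ox oy] := metacyclic_orders (erefl 12 : 3 * 4 = 12)%N x3 y4 defA nxy.
have Ax : x \in A by rewrite -defA' (subsetP (mulG_subl _ _)) ?cycle_id.
have Ay : y \in A by rewrite -defA' (subsetP (mulG_subr _ _)) ?cycle_id.
have nxA : <[x]> <| A.
  by rewrite /normal cycle_subG Ax -defA' mul_subG ?normG ?cycle_subG.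
split.
- apply/negP => cAA; have : x ^ y^-1 = x.
    by apply/conjg_fixP/commgP; apply: (centsP cAA); rewrite ?groupV.
  rewrite xyV expgS expg1 -{3}[x]mulg1 => /mulgI x1.
  by move: ox; rewrite x1 order1.
- by apply: (normal_core_order nxA); rewrite ?part12.2 // -orderE ox.
move=> K nKA cycAK; have sA'K := cyclic_quotient_der1 nKA cycAK.
have nKsub := normal_norm nKA.
have Kx : x \in K.
  rewrite (subsetP sA'K) //; have <- : [~ x, y^-1] = x.
    by rewrite commgEl xyV expgS expg1 mulKg.
  by rewrite mem_commg ?groupV.
have d12 : #|K| %| 12 by rewrite -oA cardSg // normal_sub.
have d3 : 3 %| #|K| by rewrite -ox order_dvdG.
have oK : (#|K| * #|A : K| = 12)%N by rewrite Lagrange ?normal_sub.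
have /or3P[] : [|| #|K| == 12, #|K| == 6 | #|K| == 3].
- by move: (dvd12_cases d12) d3; rewrite !inE => /or4P[|||/or3P[]] /eqP->.
- by move/eqP=> oK12; constructor 1; apply: sub12_order (normal_sub nKA) oK12.
- move/eqP=> oK6; constructor 2; rewrite isog_Zp_card // oK6 eqxx andbT.
  have iK : #|A : K| = 2 by apply/eqP; rewrite -(@eqn_pmul2l 6) // -{1}oK6 oK.
  have Ky2 : y ^+ 2 \in K.
    apply: coset_idr; first by rewrite groupX // (subsetP nKsub).
    rewrite morphX ?(subsetP nKsub) // -iK -card_quotient // expg_cardG //.
    exact: mem_quotient.
  have oy2 : #[y ^+ 2] = 2 by rewrite orderXdiv oy.
  have cx : <[y ^+ 2]> \subset 'C(<[x]>).
    rewrite cycle_subG -groupV /= cent_cycle; apply/cent1P/esym/commgP/conjg_fixP.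
    rewrite -expgVn expgS expg1 conjgM xyV conjXg xyV -expgM.
    by rewrite -[(2 * 2)%N]/(3 + 1)%N expgD x3 mul1g expg1.
  have defK : <[x]> * <[y ^+ 2]> = K.
    apply/eqP; rewrite eqEcard mul_subG ?cycle_subG // oK6 TI_cardMg.
      by rewrite -!orderE ox oy2.
    by apply: coprime_TIg; rewrite -!orderE ox oy2.
  apply: abelian6_cyclic => //; rewrite -defK abelianM !cycle_abelian /=.
  by [].
by move/eqP=> oK3; constructor 3; rewrite isog_Zp_card // prime_cyclic oK3.
Qed.

End Order12Types.

(** * Assembling the count *)
Section SemidirectProduct.

Variables (p : nat) (gF : finGroupType) (F : {group gF}).
Variable tau : {morphism F >-> {unit 'F_p}}.

(** A finite subgroup of the units of a field is cyclic. *)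
Lemma ker_cyclic_quotient : cyclic (F / 'ker tau).
Proof.
rewrite (isog_cyclic (first_isog tau)).
exact: field_unit_group_cyclic.
Qed.

Local Notation to := ('U \o tau)%gact.

(** The action of a is multiplication by tau a, which fixes 1 only if
    tau a = 1. *)
Lemma sdprod_central :
  (sdpair2 to @* (tau @*^-1 setT) \subset 'C(sdpair1 to @* [set: 'F_p]))
  = ('ker tau == F).
Proof.
rewrite sub_morphim_pre // -astabEsd ?subxx // morphpreT.
apply/subsetP/eqP => [fixF | kerF a Fa].
  apply/eqP; rewrite eqEsubset subsetIl; apply/subsetP=> a Fa.
  have fix1 : (1 * val (tau a) = 1 :> 'F_p)%R.
    exact: (astab_act (fixF a Fa) (in_setT (1%R : 'F_p))).
  by apply/kerP=> //; apply: val_inj; rewrite /= -fix1 mul1r.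
have tau1 : tau a = 1 by apply/mker; rewrite kerF.
rewrite inE /= morphpreT Fa inE; apply/subsetP=> x _; rewrite inE; apply/eqP.
by rewrite /= tau1 FinRing.unit_actE mulr1.
Qed.

Lemma Zp_sdprod_split (gT : finGroupType) : prime p ->
  [set: gT] \isog [set: Zp_sdprod tau] ->
  exists P C : {group gT}, [/\ P ><| C = [set: gT], #|P| = p, C \isog F &
    (C \subset 'C(P)) = ('ker tau == F)].
Proof.
move=> p_pr; rewrite isog_sym => /isogP[f injf im_f].
pose P1 := (sdpair1 to @* [set: 'F_p])%G.
pose C1 := (sdpair2 to @* (tau @*^-1 setT))%G.
have defS : P1 ><| C1 = [set: Zp_sdprod tau] := sdprod_sdpair to.
exists (f @* P1)%G, (f @* C1)%G; split.
- by rewrite (injm_sdprod _ injf defS) ?subxx.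
- by rewrite !card_injm ?subsetT ?injm_sdpair1 // cardsT card_Fp.
- rewrite isog_sym; apply: (@isog_trans _ _ _ _ C1).
    apply: (isog_trans _ (sub_isog (subxx _) (injm_sdpair2 to))).
    by rewrite /= morphpreT isog_refl.
  by apply: sub_isog; rewrite ?subsetT.
by rewrite (injm_cents injf) ?subsetT // sdprod_central.
Qed.

End SemidirectProduct.

Section HopfGaloisCount.

Variables (p : nat) (p_pr : prime p) (p_ge7 : 7 <= p).
Variables (gF : finGroupType) (F : {group gF}) (oF : #|F| = 12).
Variable tau : {morphism F >-> {unit 'F_p}}.
Variables (k : fieldType) (K : splittingFieldType k).
Hypothesis galK : galois 1 {:K}.
Hypothesis isoG : 'Gal({:K} / 1) \isog [set: Zp_sdprod tau].

Local Notation T := [set: 'Z_(6 * p) * 'Z_2]%G.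

Lemma num_hopfGalois_Sylow (n2 n3 : nat) :
    (forall (gT : finGroupType) (C : {group gT}), C \isog F ->
       #|'Syl_2(C)| = n2 /\ #|'Syl_3(C)| = n3) ->
  num_hopfGalois K T ((if 'ker tau == F then 1 else p) * n2 * n3)%N.
Proof.
move=> nSyl; apply: num_hopfGalois_card => //.
have galT : 'Gal({:K} / 1) = [set: gal_of {:K}].
  by apply/setP=> g; rewrite gal_kAut ?subvf // inE kAutE k1AHom limg_gal subvv.
have isoT := isoG; rewrite galT in isoT.
have [P [C [defG oP isoC cPC]]] := Zp_sdprod_split p_pr isoT.
have oC : #|C| = 12 by rewrite (card_isog isoC).
have p_gt3 : 3 < p by apply: leq_trans p_ge7.
have nPG : P <| [set: gal_of {:K}] by case/sdprod_context: defG.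
have oG : #|{: gal_of {:K}}| = (12 * p)%N.
  by rewrite -cardsT -(sdprod_card defG) oP oC mulnC.
have [n2E n3E] := nSyl _ C isoC.
rewrite (card_regular_subgroups p_pr p_gt3 oG nPG oP).
rewrite (card_subgroups_over p_pr p_gt3 defG oP oC (isT : prime 2) part12.1) n2E.
rewrite (card_subgroups_over p_pr p_gt3 defG oP oC (isT : prime 3) part12.2) n3E.
congr (_ * _ * _)%N; case: ifPn => [/eqP kerF | kerF].
  by apply: (card_complements_central p_pr p_gt3 defG oP oC); rewrite cPC kerF.
by apply: (card_complements p_pr p_gt3 defG oP oC); rewrite cPC.
Qed.

Lemma num_hopfGalois_central n2 n3 :
    (forall (gT : finGroupType) (C : {group gT}), C \isog F ->
       #|'Syl_2(C)| = n2 /\ #|'Syl_3(C)| = n3) -> 'ker tau = F ->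
  num_hopfGalois K T (n2 * n3)%N.
Proof. by move=> /num_hopfGalois_Sylow + kerF; rewrite kerF eqxx mul1n. Qed.

Lemma num_hopfGalois_noncentral n2 n3 :
    (forall (gT : finGroupType) (C : {group gT}), C \isog F ->
       #|'Syl_2(C)| = n2 /\ #|'Syl_3(C)| = n3) -> #|'ker tau| != 12 ->
  num_hopfGalois K T (n2 * n3 * p)%N.
Proof.
move=> /num_hopfGalois_Sylow + kerF; rewrite ifN; first by rewrite [(n2 * n3 * p)%N]mulnC mulnA.
by apply: contraNneq kerF => ->; rewrite oF.
Qed.

Lemma card_Syl_abelian : abelian F -> forall (gT : finGroupType) (C : {group gT}),
  C \isog F -> #|'Syl_2(C)| = 1%N /\ #|'Syl_3(C)| = 1%N.
Proof.
move=> cFF gT C isoC; have oC : #|C| = 12 by rewrite (card_isog isoC).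
by rewrite !abelian_card_Syl // (isog_abelian isoC).
Qed.

Lemma card_Syl_normal3 : ~~ abelian F -> #|'O_3(F)| = 3 ->
  forall (gT : finGroupType) (C : {group gT}),
  C \isog F -> #|'Syl_2(C)| = 3 /\ #|'Syl_3(C)| = 1%N.
Proof.
move=> cFF oO gT C isoC; have oC : #|C| = 12 by rewrite (card_isog isoC).
rewrite -(isog_abelian isoC) in cFF; rewrite -(card_isog (gFisog _ isoC)) in oO.
by have [/(_ oO)[-> ->]] := nonabelian_card_Syl oC cFF.
Qed.

Lemma card_Syl_normal2 : ~~ abelian F -> #|'O_2(F)| = 4 ->
  forall (gT : finGroupType) (C : {group gT}),
  C \isog F -> #|'Syl_2(C)| = 1%N /\ #|'Syl_3(C)| = 4.
Proof.
move=> cFF oO gT C isoC; have oC : #|C| = 12 by rewrite (card_isog isoC).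
rewrite -(isog_abelian isoC) in cFF; rewrite -(card_isog (gFisog _ isoC)) in oO.
by have [_ /(_ oO)[-> ->]] := nonabelian_card_Syl oC cFF.
Qed.

End HopfGaloisCount.

Lemma isog_Alt4_tetrahedral (gF : finGroupType) (F : {group gF}) :
  F \isog 'Alt_('I_4) -> exists v w c, tetrahedral F v w c.
Proof.
rewrite isog_sym => /isogP[f injf defF].
have [v [w [c [[Av Aw Ac] [v2 w2 c3] [v1 w1 vw] cvw [vc wc]]]]] := Alt4_tetrahedral.
exists (f v), (f w), (f c); split.
- by split; rewrite -defF mem_morphim.
- by split; rewrite -morphX ?v2 ?w2 ?c3 ?morph1.
- by split; rewrite ?morph_injm_eq1 // (inj_in_eq (injmP injf)).
- by rewrite /commute -!morphM // cvw.
by split; rewrite -?morphM -?morphJ ?vc ?wc.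
Qed.

Lemma isog_dihedral12_gens (gF : finGroupType) (F : {group gF}) : F \isog 'D_12 ->
  exists x y, [/\ <[x]> <*> <[y]> = F, x ^+ 6 = 1, y ^+ 2 = 1 & x ^ y = x^-1].
Proof.
move/isog_hom; rewrite (@Grp_dihedral 6 isT) => /existsP[[x y]] /=.
by rewrite !xpair_eqE => /and4P[/eqP defF /eqP x6 /eqP y2 /eqP xy]; exists x, y.
Qed.

Lemma isog_Dic12_gens (gF : finGroupType) (F : {group gF}) : isog_Dic12 F ->
  exists x y, [/\ <[x]> <*> <[y]> = F, x ^+ 3 = 1, y ^+ 4 = 1
                & y * x * y^-1 = x ^+ 2].
Proof.
move/isoGrp_hom => /existsP[[x y]] /=.
by rewrite !xpair_eqE => /and4P[/eqP defF /eqP x3 /eqP y4 /eqP yx]; exists x, y.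
Qed.

Lemma isog_cyclic12_kernel (gF : finGroupType) (F K : {group gF}) : #|F| = 12 ->
    F \isog [set: 'Z_12] -> K <| F ->
  K = F \/ [\/ K \isog [set: 'Z_6], K \isog [set: 'Z_4], K \isog [set: 'Z_3]
    | K \isog [set: 'Z_2] \/ K :=: 1].
Proof.
move=> oF; rewrite isog_Zp_card // => /andP[cycF _] nKF.
have sKF := normal_sub nKF; have cycK := cyclicS sKF cycF.
rewrite !isog_Zp_card // cycK /=.
have /dvd12_cases : #|K| %| 12 by rewrite -oF cardSg.
rewrite !inE => /or4P[| | |/or3P[]] /eqP oK; last by left; apply: (sub12_order oF).
- by right; constructor 4; right; apply/eqP; rewrite trivg_card1 oK.
- by right; constructor 4; left; rewrite oK.
- by right; constructor 3; rewrite oK.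
- by right; constructor 2; rewrite oK.
by right; constructor 1; rewrite oK.
Qed.

(** The order of the cyclic quotient is its exponent, which divides 6; this
    excludes kernels of order 1 and 3. *)
Lemma exponent6_kernel (gF : finGroupType) (F K : {group gF}) : #|F| = 12 ->
    abelian F -> exponent F %| 6 -> K <| F -> cyclic (F / K) ->
  K = F \/ [\/ K \isog [set: 'Z_6], K \isog [set: 'Z_2 * 'Z_2]
    | K \isog [set: 'Z_2]].
Proof.
move=> oF cFF eF nKF cycFK; have sKF := normal_sub nKF.
have oK : (#|K| * #|F : K| = 12)%N by rewrite Lagrange.
have : #|F : K| %| 6.
  rewrite -card_quotient ?normal_norm // -(exponent_cyclic cycFK).
  by apply: dvdn_trans eF; apply: exponent_morphim.
rewrite dvdn_divisors // !inE => /or4P[] /eqP iK; rewrite iK in oK.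
- by left; apply: (sub12_order oF) => //; rewrite -oK muln1.
- have {}oK : #|K| = 6 by apply/eqP; rewrite -(@eqn_pmul2r 2) // oK.
  by right; constructor 1; rewrite isog_Zp_card // oK abelian6_cyclic ?(abelianS sKF).
- have {}oK : #|K| = 4 by apply/eqP; rewrite -(@eqn_pmul2r 3) // oK.
  right; constructor 2; apply: isog_Zp2 => // x Kx; apply/eqP; rewrite -order_dvdn.
  have : #[x] %| gcdn 4 6.
    rewrite dvdn_gcd -{1}oK order_dvdG // (dvdn_trans _ eF) // dvdn_exponent //.
    exact: (subsetP sKF).
  by [].
have {}oK : #|K| = 2 by apply/eqP; rewrite -(@eqn_pmul2r 6) // oK.
by right; constructor 3; rewrite isog_Zp_card // oK prime_cyclic ?oK.
Qed.

Lemma Z6Z2_exponent (gF : finGroupType) (F : {group gF}) :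
  F \isog [set: 'Z_6 * 'Z_2] -> abelian F /\ exponent F %| 6.
Proof.
move=> isoF; rewrite (isog_abelian isoF) (exponent_isog isoF); split.
  by apply/centsP=> -[a b] _ [c d] _; congr pair; apply: addrC.
apply/exponentP=> -[a b] _.
rewrite expg_pair; congr pair; apply/eqP; rewrite -order_dvdn.
  by apply: dvdn_trans (order_dvdG (in_setT a)) _; rewrite cardsT card_ord.
by apply: dvdn_trans (order_dvdG (in_setT b)) _; rewrite cardsT card_ord.
Qed.

Theorem mainTheorem6 (p : nat) (p_prime : prime p) (p_ge7 : (7 <= p)%N)
    (gF : finGroupType) (F : {group gF}) (oF : #|F| = 12)
    (tau : {morphism F >-> {unit 'F_p}})
    (k : fieldType) (K : splittingFieldType k)
    (galK : galois 1 {:K})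
    (isoG : 'Gal({:K} / 1) \isog [set: Zp_sdprod tau]) :
  let number_is m := num_hopfGalois K [set: 'Z_(6 * p) * 'Z_2]%G m in
  [/\ F \isog [set: 'Z_12] ->
        [/\ 'ker tau = F -> number_is 1%N,
            [\/ 'ker tau \isog [set: 'Z_6], 'ker tau \isog [set: 'Z_4],
                'ker tau \isog [set: 'Z_3]
              | 'ker tau \isog [set: 'Z_2] \/ 'ker tau = 1] ->
              number_is p
          & 'ker tau = F \/
            [\/ 'ker tau \isog [set: 'Z_6], 'ker tau \isog [set: 'Z_4],
                'ker tau \isog [set: 'Z_3]
              | 'ker tau \isog [set: 'Z_2] \/ 'ker tau = 1]],
      F \isog [set: 'Z_6 * 'Z_2] ->
        [/\ 'ker tau = F -> number_is 1%N,
            [\/ 'ker tau \isog [set: 'Z_6], 'ker tau \isog [set: 'Z_2 * 'Z_2]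
              | 'ker tau \isog [set: 'Z_2]] ->
              number_is p
          & 'ker tau = F \/
            [\/ 'ker tau \isog [set: 'Z_6], 'ker tau \isog [set: 'Z_2 * 'Z_2]
              | 'ker tau \isog [set: 'Z_2]]],
      F \isog 'Alt_'I_4 ->
        [/\ 'ker tau = F -> number_is 4%N,
            'ker tau \isog [set: 'Z_2 * 'Z_2] -> number_is (4 * p)%N
          & 'ker tau = F \/ 'ker tau \isog [set: 'Z_2 * 'Z_2]],
      F \isog 'D_12 ->
        [/\ 'ker tau = F -> number_is 3%N,
            'ker tau \isog [set: 'Z_6] \/ 'ker tau \isog 'D_6 ->
              number_is (3 * p)%N
          & [\/ 'ker tau = F, 'ker tau \isog [set: 'Z_6]
              | 'ker tau \isog 'D_6]]
    & isog_Dic12 F ->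
        [/\ 'ker tau = F -> number_is 3%N,
            'ker tau \isog [set: 'Z_6] \/ 'ker tau \isog [set: 'Z_3] ->
              number_is (3 * p)%N
          & [\/ 'ker tau = F, 'ker tau \isog [set: 'Z_6]
              | 'ker tau \isog [set: 'Z_3]]]].
Proof.
move=> number_is.
have central := num_hopfGalois_central p_prime p_ge7 oF galK isoG.
have noncentral := num_hopfGalois_noncentral p_prime p_ge7 oF galK isoG.
have oZ n : 1 < n -> n < 12 -> #|[set: 'Z_n]| != 12.
  by move=> n1 n12; rewrite cardsT card_ord Zp_cast // neq_ltn n12.
have oV : #|[set: 'Z_2 * 'Z_2]| != 12 by rewrite cardsT card_Zp2.
have nker : 'ker tau <| F := ker_normal tau.
have cycq : cyclic (F / 'ker tau) := ker_cyclic_quotient tau.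
have not12 (rT : finGroupType) (B : {group rT}) :
    #|B| != 12 -> 'ker tau \isog B -> #|'ker tau| != 12.
  by move=> oB /card_isog->.
split.
- move=> isoF; have cFF : abelian F.
    by move: isoF; rewrite isog_Zp_card // => /andP[/cyclic_abelian].
  have nSyl := card_Syl_abelian oF cFF.
  split; first exact: central nSyl.
    move=> kerP; rewrite -[p]mul1n; apply: noncentral nSyl _.
    case: kerP => [||| [|->]]; last by rewrite cards1.
    + exact/not12/oZ.
    + exact/not12/oZ.
    + exact/not12/oZ.
    exact/not12/oZ.
  by case: (isog_cyclic12_kernel oF isoF nker) => [/(congr1 val) | ]; [left | right].
- move=> isoF; have [cFF eF] := Z6Z2_exponent isoF.
  have nSyl := card_Syl_abelian oF cFF.
  split; first exact: central nSyl.
    move=> kerP; rewrite -[p]mul1n; apply: noncentral nSyl _.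
    by case: kerP; apply: not12; rewrite ?oV ?oZ.
  by case: (exponent6_kernel oF cFF eF nker cycq) => [/(congr1 val) | ]; [left | right].
- move=> isoF; have [v [w [c tetF]]] := isog_Alt4_tetrahedral isoF.
  have [ncF oO ker_cases] := tetrahedral_structure oF tetF.
  have nSyl := card_Syl_normal2 oF ncF oO.
  split; first exact: central nSyl.
    by move=> kerP; apply: (noncentral 1%N 4 nSyl); apply: not12 kerP.
  by case: (ker_cases _ nker cycq) => [/(congr1 val) | ]; [left | right].
- move=> isoF; have [x [y [defF x6 y2 xy]]] := isog_dihedral12_gens isoF.
  have [ncF oO ker_cases] := dihedral12_structure oF defF x6 y2 xy.
  have nSyl := card_Syl_normal3 oF ncF oO.
  split; first exact: central nSyl.
    move=> kerP; apply: (noncentral 3 1%N nSyl).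
    case: kerP; apply: not12; first exact: oZ.
    by rewrite (@card_dihedral 3 isT).
  case: (ker_cases _ nker cycq) => [/(congr1 val) | | ];
    [constructor 1 | constructor 2 | constructor 3]; assumption.
move=> isoF; have [x [y [defF x3 y4 yx]]] := isog_Dic12_gens isoF.
have [ncF oO ker_cases] := dicyclic12_structure oF defF x3 y4 yx.
have nSyl := card_Syl_normal3 oF ncF oO.
split; first exact: central nSyl.
  move=> kerP; apply: (noncentral 3 1%N nSyl).
  by case: kerP; apply: not12; rewrite ?oZ.
case: (ker_cases _ nker cycq) => [/(congr1 val) | | ];
  [constructor 1 | constructor 2 | constructor 3]; assumption.
Qed.
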